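(* Let $R$ be a commutative ring, let $X$ be an indeterminate over $R$, and let $n,d\ge 0$ be integers, with $d\ge 1$ in (2) and (3). (1) Suppose that $\mathrm{G\text{-}gldim}(R)$ is finite. If $R[X]$ is a $G$-$(n,d)$-ring, then $R$ is a $G$-$(n,d)$-ring. (2) If $R$ is a $G$-$(n,d)$-ring which is not a $G$-$(n,d-1)$-ring, then $R[X]$ is not a $G$-$(n,d)$-ring. (3) Suppose that $\mathrm{G\text{-}gldim}(R)$ is finite. If $R[X]$ is a $G$-$(n,d)$-ring, then $R$ is a $G$-$(n,d-1)$-ring.
   Context: All rings are commutative with identity and all modules are unital. An $R$-module $M$ is Gorenstein projective if there is an exact sequence of projective modules $\mathbf P=\cdots\to P_1\to P_0\to P^0\to P^1\to\cdots$ with $M\cong \mathrm{Im}(P_0\to P^0)$ such that $\mathrm{Hom}_R(-,Q)$ leaves $\mathbf P$ exact for every projective module $Q$. $\mathrm{Gpd}_R(M)$ is the minimal length of a resolution of $M$ by Gorenstein projective modules ($\infty$ if there is no finite one), and $\mathrm{G\text{-}gldim}(R)=\sup\{\mathrm{Gpd}_R(M)\mid M \text{ an } R\text{-module}\}$. For an integer $n\ge 0$, an $R$-module $M$ is $n$-presented if there is an exact sequence $F_n\to F_{n-1}\to\cdots\to F_0\to M\to 0$ with each $F_i$ a finitely generated free $R$-module. For integers $n,d\ge 0$, $R$ is a $G$-$(n,d)$-ring if every $n$-presented $R$-module $M$ satisfies $\mathrm{Gpd}_R(M)\le d$. *)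

(* Defs.v *)
From HB Require Import structures.
From mathcomp Require Import all_boot all_order all_algebra.
From mathcomp Require Import boolp.

Set Implicit Arguments.
Unset Strict Implicit.
Unset Printing Implicit Defensive.

Import GRing.Theory.
Local Open Scope ring_scope.

(** Values in N u {oo}, encoded as [option nat] with [None] standing for oo. *)

Definition enat_inf (P : nat -> Prop) : option nat :=
  if pselect (exists k, `[< P k >]) is left h then Some (ex_minn h) else None.

Definition enat_le (x : option nat) (d : nat) : bool :=
  if x is Some k then (k <= d)%N else false.

Definition enat_finite (x : option nat) : Prop := x <> None.

Lemma enat_inf_leP (P : nat -> Prop) (d : nat) :
  enat_le (enat_inf P) d <-> exists2 k, (k <= d)%N & P k.
Proof.
rewrite /enat_inf; case: pselect => [h|h] /=.
- case: ex_minnP => k /asboolP Pk kmin; split; first by exists k.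
  by case=> l led /asboolP Pl; apply: leq_trans (kmin _ Pl) led.
- by split=> // -[k _ Pk]; case: h; exists k; apply/asboolP.
Qed.

Section Modules.
Variable R : comNzRingType.
Implicit Types A B C F M N P Q : lmodType R.

Definition surj A B (f : A -> B) : Prop := forall y, exists x, f x = y.

Definition exact_at A B C (f : {linear A -> B}) (g : {linear B -> C}) : Prop :=
  forall y : B, g y = 0 <-> exists x : A, f x = y.

(** Exactness of [Hom(C, Q) -> Hom(B, Q) -> Hom(A, Q)] in the middle. *)
Definition hom_exact_at Q A B C (f : {linear A -> B}) (g : {linear B -> C})
    : Prop :=
  forall u : {linear B -> Q},
    (forall x, u (f x) = 0) <->
    exists v : {linear C -> Q}, forall y, v (g y) = u y.

Definition projective P : Prop :=
  forall M N (p : {linear M -> N}) (f : {linear P -> N}),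
    surj p -> exists h : {linear P -> M}, forall x, p (h x) = f x.

Definition projective_exact_at A B C (f : {linear A -> B})
    (g : {linear B -> C}) : Prop :=
  exact_at f g /\ forall Q, projective Q -> hom_exact_at Q f g.

(** The doubly infinite sequence
      ... -> Pl 1 -> Pl 0 -> Pr 0 -> Pr 1 -> ...
    is given by its two halves, joined by [d0]; the injection [j] with the
    same range as [d0] is the isomorphism of [M] onto the image of [d0]. *)
Definition gorenstein_projective M : Prop :=
  exists (Pl Pr : nat -> lmodType R)
         (dl : forall i, {linear Pl i.+1 -> Pl i})
         (d0 : {linear Pl 0%N -> Pr 0%N})
         (dr : forall i, {linear Pr i -> Pr i.+1}),
  [/\ (forall i, projective (Pl i)) /\ (forall i, projective (Pr i)),
      (forall i, projective_exact_at (dl i.+1) (dl i)) /\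
        projective_exact_at (dl 0%N) d0,
      projective_exact_at d0 (dr 0%N) /\
        (forall i, projective_exact_at (dr i) (dr i.+1))
    & exists j : {linear M -> Pr 0%N},
        injective j /\
        forall y, (exists m, j m = y) <-> (exists x, d0 x = y)].

(** A resolution [0 -> G l -> ... -> G 0 -> M -> 0], extended by zero modules
    beyond degree [l]. *)
Definition gorenstein_resolution M (l : nat) : Prop :=
  exists (G : nat -> lmodType R)
         (d : forall i, {linear G i.+1 -> G i})
         (e : {linear G 0%N -> M}),
  [/\ forall i, (i <= l)%N -> gorenstein_projective (G i),
      forall i, (l < i)%N -> forall x : G i, x = 0,
      surj e,
      exact_at (d 0%N) e
    & forall i, exact_at (d i.+1) (d i)].

Definition Gpd M : option nat := enat_inf (gorenstein_resolution M).

(** The supremum of the [Gpd M], as the least of its natural upper bounds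
    (and oo if there is none). *)
Definition Ggldim : option nat :=
  enat_inf (fun k => forall M, enat_le (Gpd M) k).

Definition fg_free F : Prop :=
  exists (k : nat) (f : {linear 'rV[R]_k -> F}), bijective f.

(** Only [F 0, ..., F n] and the maps between them are constrained; there is
    no exactness condition at [F n]. *)
Definition n_presented (n : nat) M : Prop :=
  exists (F : nat -> lmodType R)
         (d : forall i, {linear F i.+1 -> F i})
         (e : {linear F 0%N -> M}),
  [/\ forall i, (i <= n)%N -> fg_free (F i),
      surj e,
      (0 < n)%N -> exact_at (d 0%N) e
    & forall i, (i.+1 < n)%N -> exact_at (d i.+1) (d i)].

Definition G_ring (n d : nat) : Prop :=
  forall M, n_presented n M -> enat_le (Gpd M) d.

End Modules.

Arguments Ggldim R : clear implicits.
Arguments G_ring R n d : clear implicits.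

(* Main.v *)
From HB Require Import structures.
From mathcomp Require Import all_boot all_order all_algebra.
From mathcomp Require Import boolp classical_sets functions.
Require Import Defs.

Set Implicit Arguments.
Unset Strict Implicit.
Unset Printing Implicit Defensive.

Import GRing.Theory.
Local Open Scope ring_scope.

(** Let [M] be an [n]-presented [R]-module. Both [M[X]] and [M], regarded as an
    [R[X]]-module killed by [X], are [n]-presented over [R[X]], and the theorem
    follows from two comparisons of dimensions.

    - If [Gpd_R M] is finite, then [Gpd_R M <= Gpd_(R[X]) M[X]]
      ([gpd_le_polyext]). This gives the descent of the [G]-[(n,d)] property.
    - If [Gpd_R M <= d + 1] and [Gpd_(R[X]) M <= d + 1], where [X] kills [M],
      then [Gpd_R M <= d] ([gpd_le_killX]). So if [R] and [R[X]] are both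
      [G]-[(n,d+1)]-rings, then [R] is a [G]-[(n,d)]-ring. This is the second
      claim in contrapositive form, and it sharpens the first one to the third.

    Usually both comparisons are read off from the groups [Ext^i(M, Q)] with
    [Q] projective, by [Ext_(R[X])^i(M[X], Q[X])] containing [Ext_R^i(M, Q)] in
    the first case and by the theorem of Rees,
    [Ext_(R[X])^(i+1)(M, Q[X]) = Ext_R^i(M, Q)], in the second. Here dimensions
    are lowered by passing to syzygies until only [Ext^1] is left, and higher
    Ext groups never occur. What makes this possible:

    - [gpd_le_syzygy]: a bound [d + 1] on the dimension of a module gives the
      bound [d] for the kernel of any surjection from a projective module onto
      it, so resolutions over [R] and over [R[X]] can be followed
      simultaneously;
    - [gp_cokernel]: if [0 -> A -> B -> K -> 0] is exact with [A] and [B]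
      Gorenstein projective and [Ext^1(K, Q) = 0] for all projective [Q], then
      [K] is Gorenstein projective. This decides the last step.

    Both rest on the closure of Gorenstein projective modules under extensions
    and under summands with projective complement. These are proved from a
    coinductive description of the class: it is the largest class whose members
    [M] satisfy [Ext^1(M, Q) = 0] for [Q] projective, embed in a projective
    module with cokernel in the class, and are quotients of a projective module
    with kernel in the class ([gp_coinduction]). *)

Local Notation "A <+> B" := (A * B)%type (at level 50, left associativity, only parsing).

(** * Linear maps, submodules and quotients *)
Section LinearMaps.
Variable R : comNzRingType.

Definition mk_linear (A B : lmodType R) (f : A -> B) (lf : linear f) :
  {linear A -> B} := HB.pack f (GRing.isLinear.Build R A B _ f lf).

Lemma mk_linearE (A B : lmodType R) (f : A -> B) (lf : linear f) x :
  mk_linear lf x = f x.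
Proof. by []. Qed.

Definition inl_lin (A B : lmodType R) : {linear A -> (A <+> B)}.
Proof.
by refine (@mk_linear A (A <+> B) (fun a => (a, 0)) _) => a u v;
  apply/pair_equal_spec; rewrite /= scaler0 addr0.
Defined.

Definition inr_lin (A B : lmodType R) : {linear B -> (A <+> B)}.
Proof.
by refine (@mk_linear B (A <+> B) (fun b => (0, b)) _) => a u v;
  apply/pair_equal_spec; rewrite /= scaler0 addr0.
Defined.

Definition copair (A B C : lmodType R) (f : {linear A -> C})
  (g : {linear B -> C}) : {linear (A <+> B) -> C}.
Proof.
refine (@mk_linear (A <+> B) C (fun x => f x.1 + g x.2) _) => a u v /=.
by rewrite !linearP scalerDr addrACA.
Defined.

Definition pairing (A B C : lmodType R) (f : {linear C -> A})
  (g : {linear C -> B}) : {linear C -> (A <+> B)}.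
Proof.
by refine (@mk_linear C (A <+> B) (fun x => (f x, g x)) _) => a u v;
  apply/pair_equal_spec; rewrite /= !linearP.
Defined.

Definition fst_lin (A B : lmodType R) : {linear (A <+> B) -> A}.
Proof. by refine (@mk_linear (A <+> B) A fst _). Defined.

Definition snd_lin (A B : lmodType R) : {linear (A <+> B) -> B}.
Proof. by refine (@mk_linear (A <+> B) B snd _). Defined.

Definition lcomp (A B C : lmodType R) (g : {linear B -> C})
  (f : {linear A -> B}) : {linear A -> C}.
Proof.
by refine (@mk_linear A C (fun x => g (f x)) _) => a u v; rewrite !linearP.
Defined.

Definition id_lin (A : lmodType R) : {linear A -> A}.
Proof. by refine (@mk_linear A A id _). Defined.

Definition opp_lin (A : lmodType R) : {linear A -> A}.
Proof.
by refine (@mk_linear A A (fun x => - x) _) => a u v; rewrite opprD scalerN.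
Defined.

Definition scale_lin (A : lmodType R) (c : R) : {linear A -> A}.
Proof.
refine (@mk_linear A A (fun v => c *: v) _) => a u v.
by rewrite scalerDr !scalerA mulrC.
Defined.

Lemma inl_linE (A B : lmodType R) (x : A) : inl_lin A B x = (x, 0).
Proof. by []. Qed.
Lemma inr_linE (A B : lmodType R) (x : B) : inr_lin A B x = (0, x).
Proof. by []. Qed.
Lemma fst_linE (A B : lmodType R) x : fst_lin A B x = x.1.
Proof. by []. Qed.
Lemma snd_linE (A B : lmodType R) x : snd_lin A B x = x.2.
Proof. by []. Qed.
Lemma copairE (A B C : lmodType R) (f : {linear A -> C})
  (g : {linear B -> C}) x : copair f g x = f x.1 + g x.2.
Proof. by []. Qed.
Lemma pairingE (A B C : lmodType R) (f : {linear C -> A})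
  (g : {linear C -> B}) x : pairing f g x = (f x, g x).
Proof. by []. Qed.
Lemma lcompE (A B C : lmodType R) (g : {linear B -> C})
  (f : {linear A -> B}) x : lcomp g f x = g (f x).
Proof. by []. Qed.
Lemma id_linE (A : lmodType R) (x : A) : id_lin A x = x.
Proof. by []. Qed.

Definition linE := (inl_linE, inr_linE, fst_linE, snd_linE, copairE, pairingE,
  lcompE, id_linE).

(** Diagram chases define their maps through this lemma and [lift_inj]: a map
    given on arbitrarily chosen preimages is linear as soon as it does not
    depend on the choice, so no explicit formula is needed. *)
Lemma lift_surj (A B C : lmodType R) (g : {linear B -> C}) (u : {linear B -> A}) :
  surj g -> (forall x, g x = 0 -> u x = 0) ->
  exists v : {linear C -> A}, forall x, v (g x) = u x.
Proof.
move=> sg ker; pose s y := sval (cid (sg y)).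
have sK y : g (s y) = y by rewrite /s; case: (cid _).
have us x y : g x = g y -> u x = u y.
  by move=> e; apply/eqP; rewrite -subr_eq0 -linearB; apply/eqP/ker;
     rewrite linearB e subrr.
have lf : linear (fun y => u (s y)).
  by move=> a y z; rewrite -linearP; apply: us; rewrite linearP !sK.
by exists (mk_linear lf) => x; apply: us; rewrite sK.
Qed.

Lemma lift_inj (A B C : lmodType R) (f : {linear A -> B}) (u : {linear C -> B}) :
  injective f -> (forall z, exists x, f x = u z) ->
  exists v : {linear C -> A}, forall z, f (v z) = u z.
Proof.
move=> fI im; pose s z := sval (cid (im z)).
have sK z : f (s z) = u z by rewrite /s; case: (cid _).
have lf : linear s by move=> a y z; apply: fI; rewrite linearP !sK linearP.
by exists (mk_linear lf).
Qed.

End LinearMaps.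

Section Submodule.
Variables (R : comNzRingType) (V : lmodType R).

(** Submodules are [Prop]-valued so that images and finite-support conditions,
    which are not decidable, are covered along with kernels. *)
Record submodule := Submodule {
  submodule_pred :> V -> Prop;
  submodule0 : submodule_pred 0;
  submoduleP : forall a u v, submodule_pred u -> submodule_pred v ->
    submodule_pred (a *: u + v) }.

Variable S : submodule.

Definition submod_pred : pred V := fun x => `[< S x >].

Fact submod_pred_closed : subsemimod_closed submod_pred.
Proof.
split; first split.
- by apply/asboolP/submodule0.
- by move=> u v /asboolP Su /asboolP Sv; apply/asboolP;
    rewrite -[u]scale1r; apply: submoduleP.
- move=> a v /asboolP Sv; apply/asboolP; rewrite -[_ *: _]addr0.
  exact: submoduleP Sv (submodule0 S).
Qed.

HB.instance Definition _ :=
  GRing.isSubmodClosed.Build R V submod_pred submod_pred_closed.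

Definition submod := {x : V | submod_pred x}.
HB.instance Definition _ := SubChoice.on submod.
HB.instance Definition _ := [SubChoice_isSubLmodule of submod by <:].

Definition submod_incl : {linear submod -> V} := val.

Lemma submod_incl_inj : injective submod_incl.
Proof. exact: val_inj. Qed.

Lemma submod_inclP x : S x <-> exists y, submod_incl y = x.
Proof.
split=> [Sx|[y <-]]; last by have /asboolP := valP y.
by exists (exist submod_pred x (asboolT Sx)).
Qed.

End Submodule.

Section Quotient.
Variables (R : comNzRingType) (V : lmodType R) (S : submodule V).

Lemma submodule_sub u v : S u -> S v -> S (u - v).
Proof. by move=> Su Sv; rewrite addrC -scaleN1r; apply: submoduleP. Qed.

(** The representative is chosen from the coset as a set, hence depends on the
    coset only. The quotient can then be carried by the elements that represent
    themselves, which makes equality of cosets Leibniz equality. *)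
Definition coset_rep (v : V) : V := xget 0 [set w | S (w - v)]%classic.

Lemma coset_repP v : S (coset_rep v - v).
Proof.
apply: (@xgetPex _ 0 [set w | S (w - v)]%classic).
by exists v; rewrite /= subrr; apply: submodule0.
Qed.

Lemma coset_rep_eq u v : S (u - v) <-> coset_rep u = coset_rep v.
Proof.
split=> [Suv|e]; last first.
  rewrite -[u](subrK (coset_rep u)) -addrA {2}e -opprB addrC.
  exact: submodule_sub (coset_repP v) (coset_repP u).
congr xget; apply/seteqP; split=> w /= Sw.
- rewrite -[w](subrK u) -addrA -[w - u]scale1r.
  exact: submoduleP.
- have -> : w - u = (w - v) - (u - v) by rewrite opprB addrA subrK.
  exact: submodule_sub.
Qed.

Lemma coset_repK v : coset_rep (coset_rep v) = coset_rep v.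
Proof. by apply/coset_rep_eq/coset_repP. Qed.

Definition quotient := {v : V | coset_rep v == v}.
HB.instance Definition _ := SubChoice.on quotient.

Definition to_quotient (v : V) : quotient :=
  exist _ (coset_rep v) (introT eqP (coset_repK v)).

Lemma to_quotient_eq u v : S (u - v) <-> to_quotient u = to_quotient v.
Proof.
split=> [/coset_rep_eq e|/(congr1 val) /=]; first exact: val_inj.
by move/coset_rep_eq.
Qed.

Lemma to_quotientK x : to_quotient (val x) = x.
Proof. by apply: val_inj; case: x => /= v /eqP. Qed.

Definition quotient_zero := to_quotient 0.
Definition quotient_opp (x : quotient) := to_quotient (- val x).
Definition quotient_add (x y : quotient) := to_quotient (val x + val y).
Definition quotient_scale a (x : quotient) := to_quotient (a *: val x).

Lemma to_quotientD u v :
  to_quotient (u + v) = quotient_add (to_quotient u) (to_quotient v).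
Proof.
apply/esym/to_quotient_eq => /=; rewrite opprD addrACA.
have := submoduleP 1 (coset_repP u) (coset_repP v).
by rewrite scale1r.
Qed.

Lemma to_quotientZ a u :
  to_quotient (a *: u) = quotient_scale a (to_quotient u).
Proof.
apply/esym/to_quotient_eq => /=; rewrite -scalerBr -[_ *: _]addr0.
exact: submoduleP (coset_repP u) (submodule0 S).
Qed.

Lemma to_quotientN u : to_quotient (- u) = quotient_opp (to_quotient u).
Proof. by rewrite -scaleN1r to_quotientZ /quotient_scale scaleN1r. Qed.

Fact quotient_addA : associative quotient_add.
Proof.
move=> x y z; rewrite -[x]to_quotientK -[y]to_quotientK -[z]to_quotientK.
by rewrite -!to_quotientD addrA.
Qed.
Fact quotient_addC : commutative quotient_add.
Proof. by move=> x y; rewrite /quotient_add addrC. Qed.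
Fact quotient_add0 : left_id quotient_zero quotient_add.
Proof. by move=> x; rewrite -[x]to_quotientK -to_quotientD add0r. Qed.
Fact quotient_addN : left_inverse quotient_zero quotient_opp quotient_add.
Proof.
by move=> x; rewrite -[x]to_quotientK -to_quotientN -to_quotientD addNr.
Qed.

HB.instance Definition _ := GRing.isZmodule.Build quotient
  quotient_addA quotient_addC quotient_add0 quotient_addN.

Fact quotient_scaleA a b x :
  quotient_scale a (quotient_scale b x) = quotient_scale (a * b) x.
Proof. by rewrite -[x]to_quotientK -!to_quotientZ scalerA. Qed.
Fact quotient_scale1 : left_id 1 quotient_scale.
Proof. by move=> x; rewrite -[x]to_quotientK -to_quotientZ scale1r. Qed.
Fact quotient_scaleDr : right_distributive quotient_scale +%R.
Proof.
move=> a x y; rewrite -[x]to_quotientK -[y]to_quotientK.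
by rewrite -[_ + _]to_quotientD -!to_quotientZ scalerDr to_quotientD.
Qed.
Fact quotient_scaleDl x : {morph quotient_scale^~ x : a b / a + b}.
Proof.
by move=> a b; rewrite -[x]to_quotientK -!to_quotientZ scalerDl to_quotientD.
Qed.

HB.instance Definition _ := GRing.Zmodule_isLmodule.Build R quotient
  quotient_scaleA quotient_scale1 quotient_scaleDr quotient_scaleDl.

Fact to_quotient_linear : linear to_quotient.
Proof. by move=> a u v; rewrite to_quotientD to_quotientZ. Qed.

Definition quotient_proj : {linear V -> quotient} :=
  mk_linear to_quotient_linear.

Lemma quotient_proj_surj : surj quotient_proj.
Proof. by move=> x; exists (val x); apply: to_quotientK. Qed.

Lemma quotient_proj_eq0 v : quotient_proj v = 0 <-> S v.
Proof. by rewrite -[X in S X]subr0; apply: iff_sym; apply: to_quotient_eq. Qed.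

End Quotient.

(** * Short exact sequences *)
Section Ses.
Variable R : comNzRingType.
Implicit Types A B C D K L M N P Q : lmodType R.

Definition ses A B C (f : {linear A -> B}) (g : {linear B -> C}) : Prop :=
  [/\ injective f, exact_at f g & surj g].

Lemma ses_comp0 A B C (f : {linear A -> B}) (g : {linear B -> C}) x :
  ses f g -> g (f x) = 0.
Proof. by case=> _ e _; apply/e; exists x. Qed.

Lemma linear_inj A B (f : {linear A -> B}) :
  (forall x, f x = 0 -> x = 0) -> injective f.
Proof.
move=> H x y e; apply/eqP; rewrite -subr_eq0; apply/eqP/H.
by rewrite linearB e subrr.
Qed.

Definition ker_submodule A B (f : {linear A -> B}) : submodule A.
Proof.
by exists (fun x => f x = 0); rewrite ?linear0 // => a u v fu fv;
  rewrite linearP fu fv scaler0 addr0.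
Defined.

Definition im_submodule A B (f : {linear A -> B}) : submodule B.
Proof.
exists (fun y => exists x, f x = y); first by exists 0; rewrite linear0.
by move=> a _ _ [x <-] [y <-]; exists (a *: x + y); rewrite linearP.
Defined.

Lemma kernel_exists A B (f : {linear A -> B}) : surj f ->
  exists K (i : {linear K -> A}), ses i f.
Proof.
move=> sf; exists (submod (ker_submodule f)), (submod_incl _); split=> //.
by move=> y; apply: (submod_inclP (ker_submodule f)).
Qed.

Lemma cokernel_exists A B (f : {linear A -> B}) : injective f ->
  exists C (g : {linear B -> C}), ses f g.
Proof.
move=> fI; exists (quotient (im_submodule f)), (quotient_proj _); split=> //.
  by move=> y; apply: (quotient_proj_eq0 (im_submodule f)).
exact: quotient_proj_surj.
Qed.

End Ses.

Section HomologicalAlgebra.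
Variable R : comNzRingType.
Implicit Types PA PC A B C D E F G K L M N P Q : lmodType R.

(** The snake lemma for the kernels of [p], of [q \o p] and of [q]. *)
Lemma kernel_of_composite N P G K M (i : {linear N -> P}) (p : {linear P -> G})
    (j : {linear K -> G}) (q : {linear G -> M}) :
  ses i p -> ses j q ->
  exists L (l : {linear L -> P}) (s : {linear N -> L}) (t : {linear L -> K}),
    [/\ ses l (lcomp q p), ses s t & forall x, l (s x) = i x].
Proof.
move=> [iI ip sp] [jI jq sq].
have sqp : surj (lcomp q p).
  by move=> m; have [g <-] := sq m; have [x <-] := sp g; exists x.
have [L [l lses]] := kernel_exists sqp; have [lI lqp _] := lses.
have [s sE] : exists s : {linear N -> L}, forall x, l (s x) = i x.
  apply: lift_inj => // x; apply/lqp; rewrite linE.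
  by have -> : p (i x) = 0; [apply/ip; exists x | rewrite linear0].
have [t tE] : exists t : {linear L -> K}, forall x, j (t x) = lcomp p l x.
  by apply: lift_inj => // x; apply/jq; apply: (ses_comp0 x lses).
exists L, l, s, t; split=> //; split.
- by move=> x y /(congr1 l); rewrite !sE => /iI.
- move=> y; split=> [ty0|[x <-]].
    have /ip[x xE] : p (l y) = 0 by have := tE y; rewrite ty0 linear0.
    by exists x; apply: lI; rewrite sE.
  apply: jI; rewrite tE linE sE linear0; apply/ip; by exists x.
- move=> k; have [x xE] := sp (j k).
  have /lqp[y yE] : lcomp q p x = 0 by rewrite linE xE; apply/jq; exists k.
  by exists y; apply: jI; rewrite tE linE yE.
Qed.

(** Third isomorphism theorem: [P / K] is an extension of [P / D] by
    [D / K]. *)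
Lemma cokernel_of_composite K D E P D' (f : {linear K -> D})
    (g : {linear D -> E}) (i : {linear D -> P}) (p : {linear P -> D'}) :
  ses f g -> ses i p ->
  exists K' (k : {linear P -> K'}) (s : {linear E -> K'})
      (t : {linear K' -> D'}), ses (lcomp i f) k /\ ses s t.
Proof.
move=> [fI fg sg] [iI ip sp].
have ifI : injective (lcomp i f) by move=> x y /iI/fI.
have [K' [k kses]] := cokernel_exists ifI; have [_ ifk sk] := kses.
have [s sE] : exists s : {linear E -> K'}, forall x, s (g x) = lcomp k i x.
  by apply: lift_surj => // x /fg[y <-]; apply: (ses_comp0 y kses).
have [t tE] : exists t : {linear K' -> D'}, forall x, t (k x) = p x.
  by apply: lift_surj => // x /ifk[y <-]; apply/ip; exists (f y).
exists K', k, s, t; split=> //; split.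
- apply: linear_inj => x; have [y <-] := sg x; rewrite sE => /ifk[z /iI <-].
  by apply/fg; exists z.
- move=> y; have [x <-] := sk y; rewrite tE; split.
    by move=> /ip[z zE]; exists (g z); rewrite sE linE zE.
  move=> [e]; have [d <-] := sg e; rewrite sE linE => /eqP.
  rewrite -subr_eq0 -linearB => /eqP /ifk [z zE]; apply/ip.
  by exists (d - f z); move: zE; rewrite linearB linE => ->; rewrite subKr.
- by move=> y; have [x <-] := sp y; exists (k x); rewrite tE.
Qed.

(** Lifting [c0] to a map into [B] turns covers of [A] and [C] into a cover of
    [B], whose kernel is an extension of the two kernels. This is what makes
    every class defined by iterated covers closed under extensions. *)
Lemma horseshoe A B C A' C' PA PC (f : {linear A -> B}) (g : {linear B -> C})
    (a1 : {linear A' -> PA}) (a0 : {linear PA -> A})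
    (c1 : {linear C' -> PC}) (c0 : {linear PC -> C}) :
  ses f g -> ses a1 a0 -> ses c1 c0 -> projective PC ->
  exists B' (b1 : {linear B' -> (PA <+> PC)}) (b0 : {linear (PA <+> PC) -> B})
      (s : {linear A' -> B'}) (t : {linear B' -> C'}), ses b1 b0 /\ ses s t.
Proof.
move=> fgses [a1I a10 sa] cses projC; have [fI fg sg] := fgses.
have [c1I c10 sc] := cses.
have [w wE] := projC _ _ g c0 sg.
pose b0 := copair (lcomp f a0) w.
have sb0 : surj b0.
  move=> b; have [z zE] := sc (g b).
  have /fg[a aE] : g (b - w z) = 0 by rewrite linearB wE zE subrr.
  have [p pE] := sa a; exists (p, z).
  by rewrite /b0 !linE /= pE aE subrK.
have [B' [b1 bses]] := kernel_exists sb0; have [b1I b10 _] := bses.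
have [s sE] : exists s : {linear A' -> B'},
    forall x, b1 (s x) = lcomp (inl_lin PA PC) a1 x.
  apply: lift_inj => // x; apply/b10; rewrite /b0 !linE /= linear0 addr0.
  by have -> : a0 (a1 x) = 0; [apply/a10; exists x | rewrite linear0].
have [t tE] : exists t : {linear B' -> C'},
    forall x, c1 (t x) = lcomp (snd_lin PA PC) b1 x.
  apply: lift_inj => // x; apply/c10; rewrite -wE !linE.
  have /(congr1 g) := ses_comp0 x bses.
  by rewrite /b0 linE linearD linE (ses_comp0 _ fgses) add0r linear0.
exists B', b1, b0, s, t; split=> //; split.
- by move=> x y /(congr1 b1); rewrite !sE !linE => -[/a1I].
- move=> y; split=> [ty0|[x <-]].
    have := ses_comp0 y bses; have := tE y; rewrite ty0 linear0 /b0 !linE.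
    case yE: (b1 y) => [p q] /= <-; rewrite linear0 addr0 -[0](linear0 f).
    move=> /fI /a10[x xE]; exists x; apply: b1I.
    by rewrite sE !linE xE yE; have := tE y; rewrite ty0 linear0 !linE yE /= => <-.
  by apply: c1I; rewrite tE linE sE !linE linear0.
- move=> z; have /fg[a aE] : g (w (c1 z)) = 0 by rewrite wE; apply/c10; exists z.
  have [p pE] := sa a.
  have /b10[y yE] : b0 (- p, c1 z) = 0.
    by rewrite /b0 !linE /= !linearN pE aE addNr.
  by exists y; apply: c1I; rewrite tE linE yE.
Qed.

(** Dual of [horseshoe]. The role of projectivity of [PC] is played by the
    extension [h] of [a0], which exists when [Ext^1(C, PA) = 0]. *)
Lemma cohorseshoe A B C A' C' PA PC (f : {linear A -> B}) (g : {linear B -> C})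
    (a0 : {linear A -> PA}) (a1 : {linear PA -> A'})
    (c0 : {linear C -> PC}) (c1 : {linear PC -> C'}) (h : {linear B -> PA}) :
  ses f g -> ses a0 a1 -> ses c0 c1 -> (forall x, h (f x) = a0 x) ->
  exists B' (b0 : {linear B -> (PA <+> PC)}) (b1 : {linear (PA <+> PC) -> B'})
      (s : {linear A' -> B'}) (t : {linear B' -> C'}), ses b0 b1 /\ ses s t.
Proof.
move=> fgses ases cses hE; have [fI fg sg] := fgses.
have [a0I a01 sa] := ases; have [c0I c01 sc] := cses.
pose b0 := pairing h (lcomp c0 g).
have b0I : injective b0.
  apply: linear_inj => b; rewrite /b0 !linE => -[hb].
  rewrite -[0](linear0 c0) => /c0I /fg[a aE].
  by move: hb; rewrite -aE hE -[0](linear0 a0) => /a0I ->; rewrite linear0.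
have [B' [b1 bses]] := cokernel_exists b0I; have [_ b01 sb] := bses.
have [s sE] : exists s : {linear A' -> B'},
    forall x, s (a1 x) = lcomp b1 (inl_lin PA PC) x.
  apply: lift_surj => // x /a01[a <-]; rewrite !linE; apply/b01; exists (f a).
  by rewrite /b0 !linE hE (ses_comp0 _ fgses) linear0.
have [t tE] : exists t : {linear B' -> C'},
    forall x, t (b1 x) = lcomp c1 (snd_lin PA PC) x.
  by apply: lift_surj => // x /b01[b <-]; rewrite !linE (ses_comp0 _ cses).
exists B', b0, b1, s, t; split=> //; split.
- apply: linear_inj => x; have [p <-] := sa x; rewrite sE !linE.
  move=> /b01[b]; rewrite /b0 !linE => -[hb].
  rewrite -[0](linear0 c0) => /c0I /fg[a aE].
  by rewrite -hb -aE hE (ses_comp0 _ ases).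
- move=> y; have [[p q] <-] := sb y; rewrite tE !linE /=; split.
    move=> /c01[c cE]; have [b bE] := sg c; exists (a1 (p - h b)).
    rewrite sE !linE; apply/eqP; rewrite -subr_eq0 -linearB; apply/eqP/b01.
    exists (- b); rewrite /b0 !linE !linearN bE cE.
    by apply/pair_equal_spec; rewrite /= sub0r addrAC subrr sub0r.
  move=> [x]; have [p' <-] := sa x; rewrite sE !linE => /eqP.
  rewrite -subr_eq0 -linearB => /eqP /b01[b]; rewrite /b0 !linE => -[_ e].
  by apply/c01; exists (- g b); rewrite linearN e sub0r opprK.
- by move=> z; have [q <-] := sc z; exists (b1 (0, q)); rewrite tE.
Qed.

Lemma projective_sum P Q : projective P -> projective Q -> projective (P <+> Q).
Proof.
move=> pP pQ M N p f sp.
have [h hE] := pP _ _ p (lcomp f (inl_lin P Q)) sp.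
have [k kE] := pQ _ _ p (lcomp f (inr_lin P Q)) sp.
exists (copair h k) => -[x y]; rewrite linE linearD hE kE !linE -linearD.
by congr (f _); apply/pair_equal_spec; rewrite /= addr0 add0r.
Qed.

Lemma projective_retract P Q (i : {linear P -> Q}) (r : {linear Q -> P}) :
  (forall x, r (i x) = x) -> projective Q -> projective P.
Proof.
move=> ri pQ M N p f sp; have [h hE] := pQ _ _ p (lcomp f r) sp.
by exists (lcomp h i) => x; rewrite linE hE linE ri.
Qed.

Lemma ses_section A B P (f : {linear A -> B}) (g : {linear B -> P}) :
  ses f g -> projective P ->
  exists s : {linear P -> B}, forall x, g (s x) = x.
Proof. by move=> [_ _ sg] pP; have [s sE] := pP _ _ g (id_lin P) sg; exists s. Qed.

Lemma ses_retraction A B P (f : {linear A -> B}) (g : {linear B -> P})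
    (s : {linear P -> B}) : ses f g -> (forall x, g (s x) = x) ->
  exists r : {linear B -> A},
    (forall x, r (f x) = x) /\ (forall y, f (r y) = y - s (g y)).
Proof.
move=> fg sE; have [fI ex _] := fg.
have lin : linear (fun y => y - s (g y)).
  by move=> a u v; rewrite [g _]linearP [s _]linearP scalerBr opprD addrACA.
have [r rE] : exists r : {linear B -> A}, forall y, f (r y) = mk_linear lin y.
  by apply: lift_inj => // y; apply/ex; rewrite mk_linearE linearB sE subrr.
exists r; split=> // x; apply: fI.
by rewrite rE mk_linearE (ses_comp0 _ fg) linear0 subr0.
Qed.

Lemma projective_kernel F P Q (f : {linear F -> P}) (g : {linear P -> Q}) :
  ses f g -> projective P -> projective Q -> projective F.
Proof.
move=> fg pP pQ; have [s sE] := ses_section fg pQ.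
by have [r [rf _]] := ses_retraction fg sE; apply: projective_retract rf pP.
Qed.

(** This is the vanishing of [Ext^1(M, Q)]. Quantifying over all presentations
    of [M], not only the projective ones, makes it immediately usable; by
    [ext1_zero_presentation] one projective presentation suffices to prove
    it. *)
Definition ext1_zero M Q : Prop :=
  forall K B (f : {linear K -> B}) (g : {linear B -> M}), ses f g ->
  forall u : {linear K -> Q}, exists v : {linear B -> Q}, forall x, v (f x) = u x.

(** A projective presentation maps to any other one, and the second is the
    pushout of the first along the induced map of kernels. The extension over
    the pushout is glued from [u] and an extension over [P]. *)
Lemma ext1_zero_presentation M Q K P (f : {linear K -> P}) (g : {linear P -> M}) :
  ses f g -> projective P ->
  (forall u : {linear K -> Q},
     exists v : {linear P -> Q}, forall x, v (f x) = u x) ->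
  ext1_zero M Q.
Proof.
move=> fg pP ext K' B f' g' fg' u.
have [fI ex sg] := fg; have [f'I ex' sg'] := fg'.
have [h hE] := pP _ _ g' g sg'.
have [k kE] : exists k : {linear K -> K'}, forall x, f' (k x) = lcomp h f x.
  by apply: lift_inj => // x; apply/ex'; rewrite linE hE (ses_comp0 _ fg).
have [w wE] := ext (lcomp u k).
have [v vE] : exists v : {linear B -> Q},
    forall x, v (copair f' h x) = copair u w x.
  apply: lift_surj => [b|[x p]].
    have [p pE] := sg (g' b).
    have /ex'[x xE] : g' (b - h p) = 0 by rewrite linearB hE pE subrr.
    by exists (x, p); rewrite !linE /= xE subrK.
  rewrite !linE /= => e.
  have /ex[y yE] : g p = 0.
    have := congr1 g' e.
    by rewrite linearD (ses_comp0 _ fg') add0r hE linear0.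
  have -> : x = - k y.
    apply: f'I; rewrite linearN kE linE yE; apply/eqP.
    by rewrite -subr_eq0 opprK e.
  by rewrite linearN -yE wE linE addNr.
by exists v => x; have := vE (x, 0); rewrite !linE /= !linear0 !addr0.
Qed.

(** [u] is extended in two steps, first to the preimage [L] of [A] in [P] and
    then from [L] to [P]. *)
Lemma ext1_zero_extension A B C Q (f : {linear A -> B}) (g : {linear B -> C}) :
  ses f g -> ext1_zero A Q -> ext1_zero C Q -> ext1_zero B Q.
Proof.
move=> fg eA eC K P i p ip u.
have [L [l [s [t [lses st ls]]]]] := kernel_of_composite ip fg.
have [v vE] := eA _ _ _ _ st u; have [w wE] := eC _ _ _ _ lses v.
by exists w => x; rewrite -ls wE vE.
Qed.

Definition is_pullback B N M E (g : {linear B -> M}) (r : {linear N -> M})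
    (e1 : {linear E -> B}) (e2 : {linear E -> N}) : Prop :=
  (forall x y, e1 x = e1 y -> e2 x = e2 y -> x = y) /\
  (forall b n, g b = r n <-> exists x, e1 x = b /\ e2 x = n).

Lemma is_pullbackC B N M E (g : {linear B -> M}) (r : {linear N -> M})
    (e1 : {linear E -> B}) (e2 : {linear E -> N}) :
  is_pullback g r e1 e2 -> is_pullback r g e2 e1.
Proof.
case=> eI ex; split=> [x y|n b]; first by move=> *; apply: eI.
have [ex1 ex2] := ex b n.
by split=> [/esym/ex1[x []]|[x [? ?]]]; [exists x | rewrite ex2 //; exists x].
Qed.

Lemma pullback_exists B N M (g : {linear B -> M}) (r : {linear N -> M}) :
  exists E (e1 : {linear E -> B}) (e2 : {linear E -> N}), is_pullback g r e1 e2.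
Proof.
pose d := copair g (lcomp (opp_lin M) r).
have dE b n : d (b, n) = 0 <-> g b = r n.
  by rewrite /d linE; split=> [/eqP|->]; rewrite ?subrr // subr_eq0 => /eqP.
pose S := ker_submodule d; pose e := submod_incl S.
exists (submod S), (lcomp (fst_lin B N) e), (lcomp (snd_lin B N) e).
split=> [x y|b n].
  rewrite !linE => e1 e2; apply: (@submod_incl_inj _ _ S).
  by rewrite [LHS]surjective_pairing [RHS]surjective_pairing e1 e2.
split=> [/dE/(submod_inclP S)[x xE]|[x [<- <-]]].
  by exists x; rewrite !linE /e xE.
apply/dE/(submod_inclP S); exists x; rewrite !linE.
exact: surjective_pairing.
Qed.

Lemma pullback_ses K B N M E (f : {linear K -> B}) (g : {linear B -> M})
    (r : {linear N -> M}) (e1 : {linear E -> B}) (e2 : {linear E -> N}) :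
  ses f g -> is_pullback g r e1 e2 ->
  exists k : {linear K -> E}, ses k e2 /\ forall x, e1 (k x) = f x.
Proof.
move=> fg [eI ex]; have [fI fgE sg] := fg.
have pI : injective (pairing e1 e2) by move=> x y [*]; apply: eI.
have [k kE] : exists k : {linear K -> E},
    forall x, pairing e1 e2 (k x) = lcomp (inl_lin B N) f x.
  apply: lift_inj => // x; have [|y [y1 y2]] := (ex (f x) 0).1.
    by rewrite linear0 (ses_comp0 _ fg).
  by exists y; rewrite pairingE y1 y2.
have k1 x : e1 (k x) = f x by have [] := kE x.
have k2 x : e2 (k x) = 0 by have [] := kE x.
exists k; split=> //; split.
- by move=> x y /(congr1 e1); rewrite !k1 => /fI.
- move=> y; split=> [y0|[x <-]]; last exact: k2.
  have /fgE[x xE] : g (e1 y) = 0.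
    have -> : g (e1 y) = r (e2 y) by apply: (ex _ _).2; exists y.
    by rewrite y0 linear0.
  by exists x; apply: eI; rewrite ?k1 ?k2 ?y0.
- move=> n; have [b bE] := sg (r n).
  by have [x [_ <-]] := (ex b n).1 bE; exists x.
Qed.

(** A presentation of [M] is a retract of its pullback along [r], which is a
    presentation of [N] with the same kernel. *)
Lemma ext1_zero_retract M N Q (i : {linear M -> N}) (r : {linear N -> M}) :
  (forall x, r (i x) = x) -> ext1_zero N Q -> ext1_zero M Q.
Proof.
move=> ri eN K B f g fg u.
have [E [e1 [e2 pb]]] := pullback_exists g r; have [eI ex] := pb.
have [k [ke2 k1]] := pullback_ses fg pb.
have pI : injective (pairing e1 e2) by move=> x y [*]; apply: eI.
have [b bE] : exists b : {linear B -> E},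
    forall x, pairing e1 e2 (b x) = pairing (id_lin B) (lcomp i g) x.
  apply: lift_inj => // x; have [|y [y1 y2]] := (ex x (i (g x))).1.
    by rewrite ri.
  by exists y; rewrite !pairingE y1 y2.
have [v vE] := eN _ _ _ _ ke2 u.
exists (lcomp v b) => x; rewrite linE -vE; congr (v _); apply: pI.
by rewrite bE !linE k1 (ses_comp0 _ fg) (ses_comp0 _ ke2) linear0.
Qed.

Lemma ext1_zero_projective P Q : projective P -> ext1_zero P Q.
Proof.
move=> pP K B f g fg u; have [s sE] := ses_section fg pP.
by have [r [rf _]] := ses_retraction fg sE; exists (lcomp u r) => x; rewrite linE rf.
Qed.

End HomologicalAlgebra.

(** * Gorenstein projective modules by coinduction *)
Section ShiftedSequences.
Variable R : comNzRingType.
Variables (X : lmodType R) (F : nat -> lmodType R).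

Definition cons_mod (i : nat) : lmodType R := if i is j.+1 then F j else X.

Definition cons_chain (e : {linear F 0%N -> X})
    (d : forall i, {linear F i.+1 -> F i}) i :
    {linear cons_mod i.+1 -> cons_mod i} :=
  if i is j.+1 return {linear cons_mod i.+1 -> cons_mod i} then d j else e.

Definition cons_cochain (e : {linear X -> F 0%N})
    (d : forall i, {linear F i -> F i.+1}) i :
    {linear cons_mod i -> cons_mod i.+1} :=
  if i is j.+1 return {linear cons_mod i -> cons_mod i.+1} then d j else e.

End ShiftedSequences.

Section GorensteinProjective.
Variable R : comNzRingType.
Implicit Types A B C D E F G K L M N P Q : lmodType R.

Definition ext1_proj_zero M : Prop := forall Q, projective Q -> ext1_zero M Q.

(** A complete resolution moved by one position to the left is a complete
    resolution of the cokernel of [M -> P^0]. *)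
Lemma gp_right_sequence M : gorenstein_projective M ->
  exists P M' (f : {linear M -> P}) (g : {linear P -> M'}),
    [/\ ses f g, projective P & gorenstein_projective M'].
Proof.
case=> Pl [Pr [dl [d0 [dr [[pl pr] [el e0] [er es] [j [jI jE]]]]]]].
have [M' [g jg]] := cokernel_exists jI; have [_ ex sg] := jg.
have [er0 _] := er.
exists (Pr 0%N), M', j, g; split=> //.
have [k kE] : exists k : {linear M' -> Pr 1%N}, forall x, k (g x) = dr 0%N x.
  by apply: lift_surj => // x /ex/jE/er0.
exists (cons_mod (Pr 0%N) Pl), (fun i => Pr i.+1), (cons_chain d0 dl).
exists (dr 0%N), (fun i => dr i.+1); split=> //.
- by split=> [[|i]|i] //=; apply: pl.
- by split=> // -[|i] //=; apply: el.
- by split=> [|i]; apply: es.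
exists k; split.
  by apply: linear_inj => x; have [y <-] := sg x; rewrite kE => /er0/jE/ex.
move=> y; split=> [[x <-]|[x <-]]; last by exists (g x); rewrite kE.
by have [z <-] := sg x; exists z; rewrite kE.
Qed.

(** A complete resolution moved by one position to the right is one of the
    kernel of [P_0 -> M]; exactness of [Hom(-, Q)] at [P_1] says precisely that
    maps from that kernel to [Q] extend to [P_0]. *)
Lemma gp_left_sequence M : gorenstein_projective M ->
  exists K P (f : {linear K -> P}) (g : {linear P -> M}),
    [/\ ses f g, projective P, gorenstein_projective K & ext1_proj_zero M].
Proof.
case=> Pl [Pr [dl [d0 [dr [[pl pr] [el e0] [er es] [j [jI jE]]]]]]].
have [e0' _] := e0.
have [g gE] : exists g : {linear Pl 0%N -> M}, forall x, j (g x) = d0 x.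
  by apply: lift_inj => // z; apply/jE; exists z.
have sg : surj g.
  move=> m; have /jE[x xE] : exists m', j m' = j m by exists m.
  by exists x; apply: jI; rewrite gE.
have [K [f fg]] := kernel_exists sg; have [fI ex _] := fg.
have fim y : (exists x, f x = y) <-> exists x, dl 0%N x = y.
  split=> [/ex /(congr1 j)|].
    by rewrite linear0 gE => /e0'.
  by move/e0' => yE; apply/ex; apply: jI; rewrite gE linear0.
exists K, (Pl 0%N), f, g; split=> //.
- exists (fun i => Pl i.+1), (cons_mod (Pl 0%N) Pr), (fun i => dl i.+1).
  exists (dl 0%N), (cons_cochain d0 dr); split=> //.
  + by split=> [i|[|i]] //=; apply: pr.
  + by split=> [|[|i]] //=; apply: es.
  + by exists f.
- move=> Q pQ; apply: (ext1_zero_presentation fg) => // u.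
  have [k kE] : exists k : {linear Pl 1%N -> K}, forall x, f (k x) = dl 0%N x.
    by apply: lift_inj => // x; apply/fim; exists x.
  have [ex1 ext] := el 0%N; have [ext' _] := ext Q pQ (lcomp u k).
  have [|v vE] := ext'.
    move=> x; rewrite linE; have -> : k (dl 1%N x) = 0.
      by apply: fI; rewrite kE linear0; apply/ex1; exists x.
    exact: linear0.
  exists v => x; have /fim[y yE] : exists x', f x' = f x by exists x.
  by rewrite -yE vE linE; congr (u _); apply: fI; rewrite kE.
Qed.

Lemma gp_iso M N (f : {linear N -> M}) : injective f -> surj f ->
  gorenstein_projective M -> gorenstein_projective N.
Proof.
move=> fI sf [Pl [Pr [dl [d0 [dr [pp el er [j [jI jE]]]]]]]].
exists Pl, Pr, dl, d0, dr; split=> //.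
exists (lcomp j f); split=> [x y /jI/fI //|y]; rewrite -jE.
split=> [[x <-]|[m <-]]; first by exists (f x).
by have [x <-] := sf m; exists x.
Qed.

(** Gorenstein projective modules form the greatest class [S] with
    [S M -> gp_step S M] for all [M] (see [gp_unfold] and [gp_coinduction]).
    Closure properties are proved by exhibiting a class [S], without
    manipulating doubly infinite complexes. *)
Definition gp_step (S : lmodType R -> Prop) M : Prop :=
  ext1_proj_zero M /\
  (exists P M' (f : {linear M -> P}) (g : {linear P -> M'}),
    [/\ ses f g, projective P & S M']) /\
  (exists K P (f : {linear K -> P}) (g : {linear P -> M}),
    [/\ ses f g, projective P & S K]).

Section Splice.
Variables (A B P X Y Z : lmodType R).
Variables (i : {linear A -> P}) (p : {linear P -> B}) (ip : ses i p).
Variables (s : {linear X -> A}) (k : {linear B -> Y}) (c : {linear Y -> Z}).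
Hypotheses (ss : surj s) (kc : ses k c).

(** Gluing short exact sequences produces an exact complex, and it stays exact
    under [Hom(-, Q)] because maps [B -> Q] extend along [k]. *)
Lemma splice_exact (f : {linear X -> P}) (g : {linear P -> Y}) :
  f =1 lcomp i s -> g =1 lcomp k p ->
  ext1_proj_zero Z -> projective_exact_at f g.
Proof.
move=> fE gE eZ; have [iI ex _] := ip; have [kI kex _] := kc.
have exfg : exact_at f g.
  move=> y; rewrite gE linE; split=> [|[x <-]].
    rewrite -[X in _ = X](linear0 k) => /kI/ex[a <-]; have [x <-] := ss a.
    by exists x; rewrite fE.
  by rewrite fE linE (ses_comp0 _ ip) linear0.
split=> // Q pQ u; split=> [u0|[v vE] x]; last first.
  by rewrite -vE (_ : g (f x) = 0) ?linear0 //; apply/exfg; exists x.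
have [w wE] : exists w : {linear B -> Q}, forall x, w (p x) = u x.
  have [_ _ sp] := ip; apply: lift_surj => // x /ex[a <-].
  by have [y <-] := ss a; have := u0 y; rewrite fE.
by have [v vE] := eZ Q pQ _ _ _ _ kc w; exists v => y; rewrite gE linE vE.
Qed.

End Splice.

Section Coinduction.
Variable S : lmodType R -> Prop.
Hypothesis S_step : forall M, S M -> gp_step S M.

Let T := {M : lmodType R | S M}.

(** The data of one step, in [Type], so that the sequences of modules and maps
    of a complete resolution can be defined by recursion on the position. *)
Record right_step (x : T) := RightStep {
  rP : lmodType R; rnext : T; rf : {linear sval x -> rP};
  rg : {linear rP -> sval rnext}; rses : ses rf rg; rproj : projective rP }.

Record left_step (x : T) := LeftStep {
  lP : lmodType R; lnext : T; lf : {linear sval lnext -> lP};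
  lg : {linear lP -> sval x}; lses : ses lf lg; lproj : projective lP }.

Lemma right_step_exists (x : T) : right_step x.
Proof.
have [_ [h _]] := S_step (proj2_sig x).
have [P /cid[M' /cid[f /cid[g [fg pP SM']]]]] := cid h.
exact: (@RightStep x P (exist _ M' SM') f g).
Qed.

Lemma left_step_exists (x : T) : left_step x.
Proof.
have [_ [_ h]] := S_step (proj2_sig x).
have [K /cid[P /cid[f /cid[g [fg pP SK]]]]] := cid h.
exact: (@LeftStep x P (exist _ K SK) f g).
Qed.

(** Iterating the steps in both directions yields short exact sequences
    end to end; their composites form a complete resolution of [M]. *)
Lemma gp_coinduction M : S M -> gorenstein_projective M.
Proof.
move=> SM; pose x0 : T := exist _ M SM.
pose RS := right_step_exists; pose LS := left_step_exists.
pose r := fix r i := if i is j.+1 then rnext (RS (r j)) else x0.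
pose l := fix l i := if i is j.+1 then lnext (LS (l j)) else x0.
pose Pr i := rP (RS (r i)); pose Pl i := lP (LS (l i)).
pose dl i : {linear Pl i.+1 -> Pl i} := lcomp (lf (LS (l i))) (lg (LS (l i.+1))).
pose d0 : {linear Pl 0%N -> Pr 0%N} := lcomp (rf (RS x0)) (lg (LS x0)).
pose dr i : {linear Pr i -> Pr i.+1} := lcomp (rf (RS (r i.+1))) (rg (RS (r i))).
have ext (x : T) : ext1_proj_zero (sval x) by have [] := S_step (proj2_sig x).
have sR (x : T) : surj (rg (RS x)) by case: (rses (RS x)).
have sL (x : T) : surj (lg (LS x)) by case: (lses (LS x)).
exists Pl, Pr, dl, d0, dr; split.
- by split=> i; [apply: lproj | apply: rproj].
- split=> [i|].
    by apply: (splice_exact (lses (LS (l i.+1))) (sL _) (lses (LS (l i)))) => //; apply: ext.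
  by apply: (splice_exact (lses (LS x0)) (sL _) (rses (RS x0))) => //; apply: ext.
- split=> [|i].
    by apply: (splice_exact (rses (RS x0)) (sL _) (rses (RS (r 1%N)))) => //; apply: ext.
  by apply: (splice_exact (rses (RS (r i.+1))) (sR _) (rses (RS (r i.+2)))) => //; apply: ext.
- exists (rf (RS x0)); split; first by case: (rses (RS x0)).
  move=> y; split=> [[m <-]|[x <-]]; last by exists (lg (LS x0) x).
  by have [x <-] := sL x0 m; exists x.
Qed.

End Coinduction.

End GorensteinProjective.

(** * Closure properties of Gorenstein projective modules *)
Section GorensteinClosure.
Variable R : comNzRingType.
Implicit Types PA PC A B C D E F G K L M N P Q : lmodType R.

Definition zero_lin A B : {linear A -> B}.
Proof.
by refine (@mk_linear R A B (fun=> 0) _) => a u v; rewrite scaler0 addr0.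
Defined.

Lemma ses_id0 A (Z : lmodType R) : (forall z : Z, z = 0) ->
  ses (id_lin A) (zero_lin A Z).
Proof.
move=> z0; split=> //.
- by move=> y; split=> // _; exists y.
- by move=> z; exists 0; rewrite [RHS]z0.
Qed.

Lemma ses_0id A (Z : lmodType R) : (forall z : Z, z = 0) ->
  ses (zero_lin Z A) (id_lin A).
Proof.
move=> z0; split=> //.
- by move=> x y _; rewrite (z0 x) (z0 y).
- by move=> y; split=> [y0|[x <-] //]; exists 0; apply: esym y0.
- by move=> y; exists y.
Qed.

Lemma ses_sum A B : ses (inl_lin A B) (snd_lin A B).
Proof.
split.
- by move=> x y [].
- by move=> [x y]; split=> /= [->|[z [_ <-]] //]; exists x.
- by move=> y; exists (0, y).
Qed.

Lemma rV0_eq0 (z : 'rV[R]_0) : z = 0.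
Proof. by rewrite [z]thinmx0. Qed.

Lemma projective_zero (Z : lmodType R) : (forall z : Z, z = 0) -> projective Z.
Proof.
move=> z0 M N p f sp; exists (zero_lin Z M) => x.
by rewrite (z0 x) !linear0.
Qed.

Lemma gp_unfold M : gorenstein_projective M ->
  gp_step (@gorenstein_projective R) M.
Proof.
move=> gM; have [K [P [f [g [fg pP gK eM]]]]] := gp_left_sequence gM.
by split=> //; split; [apply: gp_right_sequence | exists K, P, f, g].
Qed.

Lemma gp_projective P : projective P -> gorenstein_projective P.
Proof.
move=> pP; apply: (gp_coinduction (S := @projective R)) pP => {}P pP.
have pZ := projective_zero rV0_eq0.
split; first by move=> Q _; apply: ext1_zero_projective.
split.
  by exists P, 'rV[R]_0, (id_lin P), (zero_lin _ _); split=> //;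
     apply/ses_id0/rV0_eq0.
by exists 'rV[R]_0, P, (zero_lin _ _), (id_lin P); split=> //;
   apply/ses_0id/rV0_eq0.
Qed.

(** Coinduction on the class of extensions: [horseshoe] and [cohorseshoe] send
    an extension of Gorenstein projective modules to another one. *)
Lemma gp_extension A B C (f : {linear A -> B}) (g : {linear B -> C}) :
  ses f g -> gorenstein_projective A -> gorenstein_projective C ->
  gorenstein_projective B.
Proof.
move=> fg gA gC.
pose S (X : lmodType R) := exists A C (f : {linear A -> X}) (g : {linear X -> C}),
  [/\ ses f g, gorenstein_projective A & gorenstein_projective C].
apply: (gp_coinduction (S := S)); last by exists A, C, f, g.
move=> {fg gA gC f g A B C} B [A [C [f [g [fg gA gC]]]]].
have [eA [[PA [A' [a0 [a1 [aS pPA gA']]]]] [A2 [QA [a2 [a3 [aT pQA gA2]]]]]]] :=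
  gp_unfold gA.
have [eC [[PC [C' [c0 [c1 [cS pPC gC']]]]] [C2 [QC [c2 [c3 [cT pQC gC2]]]]]]] :=
  gp_unfold gC.
split; first by move=> Q pQ; apply: ext1_zero_extension fg (eA Q pQ) (eC Q pQ).
split.
- have [h hE] := eC PA pPA _ _ _ _ fg a0.
  have [B' [b0 [b1 [s [t [bS stS]]]]]] := cohorseshoe fg aS cS hE.
  exists (PA <+> PC), B', b0, b1; split=> //; first exact: projective_sum.
  by exists A', C', s, t.
- have [B' [b1 [b0 [s [t [bS stS]]]]]] := horseshoe fg aT cT pQC.
  exists B', (QA <+> QC), b1, b0; split=> //; first exact: projective_sum.
  by exists A2, C2, s, t.
Qed.

(** The sequence splits, so [K] is a summand of [D]. Only its first step on
    either side needs work: the kernel on the left is the one for [D], and the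
    cokernel on the right is an extension of the one for [D] by [P]. *)
Lemma gp_kernel K D P (f : {linear K -> D}) (g : {linear D -> P}) :
  ses f g -> gorenstein_projective D -> projective P ->
  gorenstein_projective K.
Proof.
move=> fg gD pP.
apply: (gp_coinduction (S := fun X => gorenstein_projective X \/ X = K));
  last by right.
move=> X [gX|->{X}].
  have [eX [[P' [X' [? [? [? ? ?]]]]] [X2 [P2 [? [? [? ? ?]]]]]]] := gp_unfold gX.
  split=> //; split; first by do 4 eexists; split; eauto.
  by do 4 eexists; split; eauto.
have [eD [[P1 [D' [d0 [d1 [dS pP1 gD']]]]] [D2 [F [d2 [d3 [dT pF gD2]]]]]]] :=
  gp_unfold gD.
have [s sE] := ses_section fg pP; have [r [rf _]] := ses_retraction fg sE.
split; first by move=> Q pQ; apply: ext1_zero_retract rf (eD Q pQ).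
split.
- have [K' [k [s' [t [kS stS]]]]] := cokernel_of_composite fg dS.
  exists P1, K', (lcomp d0 f), k; split=> //; left.
  exact: gp_extension stS (gp_projective pP) gD'.
- have [L [l [s' [t [lS stS _]]]]] := kernel_of_composite dT fg.
  exists D2, L, s', t; split=> //; last by left.
  exact: projective_kernel lS pF pP.
Qed.

(** Embed [A] in a projective [PA] with Gorenstein projective cokernel [A'].
    Since [Ext^1(K, PA) = 0], the pushout of [B] along [A -> PA] is
    [K + PA], so that [K + PA] is an extension of [A'] by [B]; then [K] is a
    summand with projective complement. *)
Lemma gp_cokernel A B K (f : {linear A -> B}) (g : {linear B -> K}) :
  ses f g -> gorenstein_projective A -> gorenstein_projective B ->
  ext1_proj_zero K -> gorenstein_projective K.
Proof.
move=> fg gA gB eK; have [fI ex sg] := fg.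
have [PA [A' [a0 [a1 [aS pPA gA']]]]] := gp_right_sequence gA.
have [a0I aE sa] := aS.
have [h hE] := eK PA pPA _ _ _ _ fg a0.
pose c := copair (pairing g h) (inr_lin K PA).
have cE b p : c (b, p) = (g b, h b + p).
  by rewrite /c !linE /=; apply/pair_equal_spec; rewrite /= addr0.
have sc : surj c.
  move=> [k p]; have [b bE] := sg k; exists (b, p - h b).
  by rewrite cE bE addrC subrK.
have [d dE] : exists d : {linear (K <+> PA) -> A'},
    forall x, d (c x) = lcomp a1 (snd_lin B PA) x.
  apply: lift_surj => // -[b p]; rewrite cE !linE /= => -[/ex[a <-]].
  rewrite hE addrC => /eqP; rewrite addr_eq0 => /eqP ->.
  by rewrite linearN (ses_comp0 _ aS) oppr0.
have dS : ses (pairing g h) d.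
  split.
  - apply: linear_inj => b; rewrite linE => -[/ex[a <-]]; rewrite hE.
    by rewrite -[0](linear0 a0) => /a0I ->; rewrite linear0.
  - move=> y; have [[b p] <-] := sc y; rewrite dE cE !linE /=.
    split=> [/aE[a <-]|[b' [gE hb]]].
      exists (b + f a); rewrite /= !linearD hE (ses_comp0 _ fg) addr0.
      by [].
    apply/aE; have /ex[a aE'] : g (b' - b) = 0 by rewrite linearB gE subrr.
    by exists a; rewrite -hE aE' linearB hb addrC addKr.
  - by move=> y; have [p <-] := sa y; exists (c (0, p)); rewrite dE.
apply: gp_kernel (ses_sum K PA) _ pPA.
exact: gp_extension dS gB gA'.
Qed.

End GorensteinClosure.

(** * Gorenstein projective dimension *)
Section GorensteinDimension.
Variable R : comNzRingType.
Implicit Types A B C D E F G K L M N P Q : lmodType R.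

(** Resolutions here are projective except for their last term, unlike those of
    [gorenstein_resolution]: projective terms are what makes [horseshoe]
    applicable. The two notions agree by [Gpd_leP]. *)
Fixpoint gpd_le (d : nat) M : Prop :=
  if d is e.+1 then
    exists K P (f : {linear K -> P}) (g : {linear P -> M}),
      [/\ ses f g, projective P & gpd_le e K]
  else gorenstein_projective M.

Lemma gp_gpd_le d M : gorenstein_projective M -> gpd_le d M.
Proof.
elim: d M => [|d IH] M gM //=.
have [K [P [f [g [fg pP gK _]]]]] := gp_left_sequence gM.
by exists K, P, f, g; split=> //; apply: IH.
Qed.

Lemma gpd_leS d M : gpd_le d M -> gpd_le d.+1 M.
Proof.
elim: d M => [|d IH] M; first exact: gp_gpd_le.
by move=> [K [P [f [g [fg pP gK]]]]]; exists K, P, f, g; split=> //; apply: IH.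
Qed.

Lemma gpd_le_mono d e M : (d <= e)%N -> gpd_le d M -> gpd_le e M.
Proof.
by move/subnKC <-; elim: (e - d)%N => [|k IH] gM; rewrite ?addn0 // addnS;
   apply/gpd_leS/IH.
Qed.

Lemma gpd_le_extension d A B C (f : {linear A -> B}) (g : {linear B -> C}) :
  ses f g -> gpd_le d A -> gpd_le d C -> gpd_le d B.
Proof.
elim: d A B C f g => [|d IH] A B C f g fg /=; first exact: gp_extension fg.
move=> [A' [PA [a1 [a0 [aS pA gA]]]]] [C' [PC [c1 [c0 [cS pC gC]]]]].
have [B' [b1 [b0 [s [t [bS stS]]]]]] := horseshoe fg aS cS pC.
exists B', (PA <+> PC), b1, b0; split=> //; first exact: projective_sum.
exact: IH stS gA gC.
Qed.

(** The kernel of [P -> B -> C] is an extension of [A] by the kernel of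
    [P -> B]. *)
Lemma gpd_le_cokernel d A B C (f : {linear A -> B}) (g : {linear B -> C}) :
  ses f g -> gpd_le d A -> gpd_le d.+1 B -> gpd_le d.+1 C.
Proof.
move=> fg gA [B' [P [b1 [b0 [bS pP gB]]]]].
have [L [l [s [t [lS stS _]]]]] := kernel_of_composite bS fg.
exists L, P, l, (lcomp g b0); split=> //.
exact: gpd_le_extension stS gB gA.
Qed.

Lemma gpd_le_kernel d K L P (f : {linear K -> L}) (g : {linear L -> P}) :
  ses f g -> gpd_le d L -> projective P -> gpd_le d K.
Proof.
case: d => [|d] fg /=; first exact: gp_kernel fg.
move=> [L' [F [i [p [ip pF gL]]]]] pP.
have [N [n [s [t [nS stS _]]]]] := kernel_of_composite ip fg.
by exists L', N, s, t; split=> //; apply: projective_kernel nS pF pP.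
Qed.

(** The bound passes to every projective presentation, not only to the one that
    witnesses it. As in the lemma of Schanuel, the pullback of two presentations
    of [M] is an extension of a projective module by either kernel. *)
Lemma gpd_le_syzygy d M K P (f : {linear K -> P}) (g : {linear P -> M}) :
  ses f g -> projective P -> gpd_le d M -> gpd_le d.-1 K.
Proof.
move=> fg pP gM.
have [K0 [P0 [f0 [g0 [fg0 pP0 gK0]]]]] : exists K0 P0 (f0 : {linear K0 -> P0})
    (g0 : {linear P0 -> M}), [/\ ses f0 g0, projective P0 & gpd_le d.-1 K0].
  case: d gM => [|d] //= gM.
  have [K0 [P0 [f0 [g0 [fg0 pP0 gK0 _]]]]] := gp_left_sequence gM.
  by exists K0, P0, f0, g0.
have [E [e1 [e2 pb]]] := pullback_exists g g0.
have [k [kS _]] := pullback_ses fg pb.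
have [k0 [k0S _]] := pullback_ses fg0 (is_pullbackC pb).
apply: gpd_le_kernel kS _ pP0.
exact: gpd_le_extension k0S gK0 (gp_gpd_le _ (gp_projective pP)).
Qed.

Lemma gpd_le_resolution d M : gpd_le d M -> gorenstein_resolution M d.
Proof.
elim: d M => [|d IH] M /=.
  move=> gM; exists (cons_mod M (fun=> 'rV[R]_0)).
  exists (cons_chain (zero_lin _ _) (fun=> zero_lin _ _)), (id_lin M); split.
  - by case.
  - by case=> // i _ x; apply: rV0_eq0.
  - by move=> x; exists x.
  - by move=> x; split=> [x0|[y <-] //]; exists 0; apply: esym x0.
  - case=> [|i] y /=; split=> // _; exists 0; rewrite [RHS]rV0_eq0;
      exact: rV0_eq0.
move=> [K [P [f [g [fg pP /IH[G [dG [e [gG G0 se ex exi]]]]]]]]].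
have [fI fgE sg] := fg.
exists (cons_mod P G), (cons_chain (lcomp f e) dG), g; split=> //.
- by case=> [_|i] /=; [apply: gp_projective | apply: gG].
- by case=> //= i; apply: G0.
- move=> y; split=> [/fgE[x <-]|[x <-]]; last exact: (ses_comp0 _ fg).
  by have [z <-] := se x; exists z.
- case=> [|i] //=; move=> y; split=> [|/ex e0]; last by rewrite linE e0 linear0.
  by rewrite linE -[X in _ = X](linear0 f) => /fI/ex.
Qed.

Lemma resolution_gpd_le d M : gorenstein_resolution M d -> gpd_le d M.
Proof.
elim: d M => [|d IH] M [G [dG [e [gG G0 se ex exi]]]].
  have eI : injective e.
    by apply: linear_inj => x /ex[y <-]; rewrite (G0 _ _ y) ?linear0.
  have [f fE] : exists f : {linear M -> G 0%N}, forall x, f (e x) = id_lin _ x.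
    by apply: lift_surj => // x; rewrite -[X in _ = X](linear0 e) => /eI.
  have [eL _] : injective f /\ surj f.
    split; last by move=> x; exists (e x); rewrite fE.
    apply: linear_inj => x; have [y <-] := se x; rewrite fE linE => ->.
    exact: linear0.
  apply: (gp_iso eL) (gG 0%N _) => //.
  by move=> x; exists (e x); rewrite fE.
have [K [f fe]] := kernel_exists se; have [fI feE _] := fe.
have [t tE] : exists t : {linear G 1%N -> K}, forall x, f (t x) = dG 0%N x.
  by apply: lift_inj => // x; apply/feE/ex; exists x.
have gK : gpd_le d K.
  apply: IH; exists (fun i => G i.+1), (fun i => dG i.+1), t; split=> //.
  - by move=> i di; apply: gG.
  - by move=> i di; apply: G0.
  - move=> k; have /ex[x xE] : e (f k) = 0 by apply/feE; exists k.
    by exists x; apply: fI; rewrite tE.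
  - move=> y; rewrite -exi -tE.
    by split=> [->|]; rewrite ?linear0 // -[X in _ = X](linear0 f) => /fI.
apply: gpd_le_cokernel fe gK _; apply: gp_gpd_le.
exact: gG.
Qed.

Lemma Gpd_leP d M : enat_le (Gpd M) d <-> gpd_le d M.
Proof.
rewrite /Gpd enat_inf_leP; split=> [[k kd /resolution_gpd_le]|gM].
  exact: gpd_le_mono.
by exists d => //; apply: gpd_le_resolution.
Qed.

End GorensteinDimension.

(** * Modules over the polynomial ring *)
Section PolynomialModules.
Variable R : comNzRingType.

Lemma poly_linear (M N : lmodType {poly R}) (f : M -> N) :
  {morph f : x y / x + y} -> (forall a x, f (a%:P *: x) = a%:P *: f x) ->
  (forall x, f ('X *: x) = 'X *: f x) -> linear f.
Proof.
move=> fD fC fX; suff fZ p x : f (p *: x) = p *: f x.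
  by move=> p x y; rewrite fD fZ.
elim/poly_ind: p x => [|p a IH] x.
  by have := fC 0 x; rewrite polyC0.
by rewrite !scalerDl fD fC -!scalerA IH fX.
Qed.

Lemma linear_scale (V W : lmodType R) (f : {linear V -> W}) a x :
  f (a *: x) = a *: f x.
Proof. exact: linearZ. Qed.

Lemma linear_sum_ord (V W : lmodType R) (f : {linear V -> W}) n (F : nat -> V) :
  f (\sum_(i < n) F i) = \sum_(i < n) f (F i).
Proof.
elim: n => [|n IH]; first by rewrite !big_ord0 linear0.
by rewrite !big_ord_recr linearD IH.
Qed.

Section Endomorphism.
(** A module over [R[X]] is an [R]-module with an endomorphism, the action of
    [X]. Both the extension [M[X]] and [M] with [X] acting by zero arise so. *)
Definition endo_module (V : lmodType R) (phi : {linear V -> V}) : Type := V.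

HB.instance Definition _ (V : lmodType R) (phi : {linear V -> V}) :=
  GRing.Zmodule.copy (endo_module phi) V.

Variables (V : lmodType R) (phi : {linear V -> V}).
Implicit Types (p q : {poly R}) (u v : V).

Definition endo_act_term p v (i : nat) : V := p`_i *: iter i phi v.

Definition endo_act p v : V := \sum_(i < size p) endo_act_term p v i.

Lemma endo_act_widen n p v : (size p <= n)%N ->
  endo_act p v = \sum_(i < n) endo_act_term p v i.
Proof.
move=> le_pn; rewrite /endo_act (big_ord_widen n (endo_act_term p v)) //.
rewrite big_mkcond; apply: eq_bigr => i _; case: ltnP => // le_pi.
by rewrite /endo_act_term nth_default // scale0r.
Qed.

Lemma endo_actDl p q v : endo_act (p + q) v = endo_act p v + endo_act q v.
Proof.
pose n := maxn (size p) (size q).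
rewrite (@endo_act_widen n) ?size_polyD // (@endo_act_widen n p) ?leq_maxl //.
rewrite (@endo_act_widen n q) ?leq_maxr // -big_split; apply: eq_bigr => i _.
by rewrite /endo_act_term coefD scalerDl.
Qed.

Lemma endo_actC a v : endo_act a%:P v = a *: v.
Proof.
by rewrite (@endo_act_widen 1) ?size_polyC_leq1 // big_ord1 /endo_act_term coefC eqxx.
Qed.

Lemma endo_actDr p u v : endo_act p (u + v) = endo_act p u + endo_act p v.
Proof.
rewrite /endo_act -big_split /=; apply: eq_bigr => i _; rewrite /endo_act_term -scalerDr.
by congr (_ *: _); elim: (i : nat) => //= k ->; rewrite linearD.
Qed.

Lemma endo_actX p v : endo_act (p * 'X) v = phi (endo_act p v).
Proof.
rewrite (@endo_act_widen (size p).+1); last first.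
  by rewrite (leq_trans (size_polyMleq _ _)) // size_polyX addn2.
rewrite big_ord_recl [X in X + _]/endo_act_term coefMX eqxx scale0r add0r /endo_act.
rewrite (linear_sum_ord phi (size p) (endo_act_term p v)).
by apply: eq_bigr => i _; rewrite /endo_act_term coefMX /= linearZ.
Qed.

Lemma endo_actM p q v : endo_act p (endo_act q v) = endo_act (p * q) v.
Proof.
elim/poly_ind: p => [|p a IH].
  by rewrite mul0r /endo_act size_poly0 !big_ord0.
rewrite mulrDl !endo_actDl endo_actX IH -endo_actX -mulrA (mulrC q) mulrA; congr (_ + _).
rewrite endo_actC mul_polyC (@endo_act_widen (size q) (a *: q)) ?size_scale_leq // /endo_act.
rewrite (linear_sum_ord (scale_lin V a)).
by apply: eq_bigr => i _; rewrite /endo_act_term /= coefZ scalerA.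
Qed.

Fact endo_act1 : left_id 1 endo_act.
Proof. by move=> v; rewrite -polyC1 endo_actC scale1r. Qed.

Fact endo_actDr' : right_distributive endo_act +%R.
Proof. by move=> p u v; apply: endo_actDr. Qed.

Fact endo_actDl' v : {morph endo_act^~ v : p q / p + q}.
Proof. by move=> p q; apply: endo_actDl. Qed.

HB.instance Definition _ :=
  GRing.Zmodule_isLmodule.Build {poly R} (endo_module phi) endo_actM endo_act1 endo_actDr' endo_actDl'.

Lemma endo_moduleC a (v : endo_module phi) : a%:P *: v = a *: (v : V).
Proof. exact: endo_actC. Qed.

Lemma endo_moduleX (v : endo_module phi) : 'X *: v = phi v.
Proof.
rewrite -[RHS](congr1 phi (endo_act1 v)) -[LHS]/(endo_act 'X v).
by rewrite -endo_actX mul1r.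
Qed.

End Endomorphism.

Section Restriction.
Variable N : lmodType {poly R}.

Definition restrict_scalars : Type := N.

HB.instance Definition _ := GRing.Zmodule.copy restrict_scalars N.

Definition restrict_scale (a : R) (x : restrict_scalars) : restrict_scalars := a%:P *: (x : N).

Fact restrict_scaleA a b x : restrict_scale a (restrict_scale b x) = restrict_scale (a * b) x.
Proof. by rewrite /restrict_scale scalerA polyCM. Qed.
Fact restrict_scale1 : left_id 1 restrict_scale.
Proof. by move=> x; rewrite /restrict_scale scale1r. Qed.
Fact restrict_scaleDr : right_distributive restrict_scale +%R.
Proof. by move=> a x y; apply: (scalerDr a%:P (x : N)). Qed.
Fact restrict_scaleDl x : {morph restrict_scale^~ x : a b / a + b}.
Proof. by move=> a b; rewrite /restrict_scale polyCD scalerDl. Qed.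

HB.instance Definition _ :=
  GRing.Zmodule_isLmodule.Build R restrict_scalars restrict_scaleA restrict_scale1 restrict_scaleDr
    restrict_scaleDl.

Lemma restrict_scalarsE a (x : restrict_scalars) : a *: x = a%:P *: (x : N).
Proof. by []. Qed.

End Restriction.

Definition restrict_lin (M N : lmodType {poly R}) (f : {linear M -> N}) :
  {linear restrict_scalars M -> restrict_scalars N}.
Proof.
refine (@mk_linear R (restrict_scalars M) (restrict_scalars N) f _) => a x y.
by rewrite !restrict_scalarsE; apply: linearP.
Defined.

Section Extension.
Variable M : lmodType R.

Definition fin_supp : submodule (nat -> M : lmodType R).
Proof.
exists (fun s => exists n, forall i, (n <= i)%N -> s i = 0); first by exists 0%N.
move=> a u v [n un] [m vm]; exists (maxn n m) => i; rewrite geq_max.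
case/andP=> ni mi; have -> : (a *: u + v) i = a *: u i + v i by [].
by rewrite un // vm // scaler0 addr0.
Defined.

Let FS : lmodType R := submod fin_supp.
Let fs_val (s : FS) : nat -> M := submod_incl fin_supp s.

Let fs_ext (s t : FS) : (forall i, fs_val s i = fs_val t i) -> s = t.
Proof. by move=> st; apply: (@submod_incl_inj _ _ fin_supp); apply/funext. Qed.

Let fs_build (s : nat -> M) n :
  (forall i, (n <= i)%N -> s i = 0) -> exists t, forall i, fs_val t i = s i.
Proof.
move=> sn; have /submod_inclP[t tE] : fin_supp s by exists n.
by exists t => i; rewrite /fs_val tE.
Qed.

Let fs_supp s : exists n, forall i, (n <= i)%N -> fs_val s i = 0.
Proof. by apply/(submod_inclP fin_supp); exists s. Qed.

Let fs_shift : exists phi : {linear FS -> FS}, forall s i,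
  fs_val (phi s) i = if i is j.+1 then fs_val s j else 0.
Proof.
have h s : exists t, forall i,
    fs_val t i = if i is j.+1 then fs_val s j else 0.
  have [n sn] := fs_supp s.
  by apply: (@fs_build _ n.+1) => -[|i] //; apply: sn.
pose f s := sval (cid (h s)).
have fE s : forall i, fs_val (f s) i = if i is j.+1 then fs_val s j else 0.
  by rewrite /f; case: cid.
have fl : linear f.
  move=> a s t; apply: fs_ext => -[|i]; rewrite fE.
    by rewrite -[RHS]/(a *: fs_val (f s) 0%N + fs_val (f t) 0%N) !fE scaler0 addr0.
  by rewrite -[RHS]/(a *: fs_val (f s) i.+1 + fs_val (f t) i.+1) !fE.
by exists (mk_linear fl) => s i; rewrite mk_linearE.
Qed.

(** [M[X]], carried by the finitely supported sequences in [M], with [X] acting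
    as the shift. *)
Definition polyext : lmodType {poly R} := endo_module (sval (cid fs_shift)).

Definition pcoef (s : polyext) (i : nat) : M := fs_val s i.

Lemma pcoef_ext s t : (forall i, pcoef s i = pcoef t i) -> s = t.
Proof. exact: fs_ext. Qed.

Lemma polyext_build (s : nat -> M) n : (forall i, (n <= i)%N -> s i = 0) ->
  exists t : polyext, forall i, pcoef t i = s i.
Proof. exact: fs_build. Qed.

Lemma pcoef_supp s : exists n, forall i, (n <= i)%N -> pcoef s i = 0.
Proof. exact: fs_supp. Qed.

Lemma pcoefD s t i : pcoef (s + t) i = pcoef s i + pcoef t i.
Proof. by []. Qed.

Lemma pcoef0 i : pcoef 0 i = 0.
Proof. by []. Qed.

Lemma pcoefC a s i : pcoef (a%:P *: s) i = a *: pcoef s i.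
Proof. by rewrite [_ *: _]endo_moduleC. Qed.

Lemma pcoefX s i : pcoef ('X *: s) i = if i is j.+1 then pcoef s j else 0.
Proof. by rewrite [_ *: _]endo_moduleX /pcoef; case: cid. Qed.

Lemma pconst_subproof : exists f : M -> polyext,
  forall m i, pcoef (f m) i = if i is 0%N then m else 0.
Proof.
have h m : exists t : polyext, forall i, pcoef t i = if i is 0%N then m else 0.
  by apply: (@polyext_build _ 1%N) => -[].
by exists (fun m => sval (cid (h m))) => m; case: cid.
Qed.

Definition pconst : M -> polyext := sval (cid pconst_subproof).

Lemma pcoef_const m i : pcoef (pconst m) i = if i is 0%N then m else 0.
Proof. by rewrite /pconst; case: cid. Qed.

Lemma pconstD : {morph pconst : m n / m + n}.
Proof.
by move=> m n; apply: pcoef_ext => -[|i]; rewrite pcoefD !pcoef_const ?addr0.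
Qed.

Lemma pconstC a m : pconst (a *: m) = a%:P *: pconst m.
Proof.
by apply: pcoef_ext => -[|i]; rewrite pcoefC !pcoef_const ?scaler0.
Qed.

Lemma polyext_decomp s : exists t, s = pconst (pcoef s 0) + 'X *: t.
Proof.
have [n sn] := pcoef_supp s.
have [|t tE] := @polyext_build (fun i => pcoef s i.+1) n.
  by move=> i /leqW/sn.
exists t; apply: pcoef_ext => -[|i]; rewrite pcoefD pcoefX pcoef_const.
  by rewrite addr0.
by rewrite tE add0r.
Qed.

Lemma polyext_ind (S : polyext -> Prop) :
  (forall m, S (pconst m)) -> (forall s t, S s -> S t -> S (s + t)) ->
  (forall s, S s -> S ('X *: s)) -> forall s, S s.
Proof.
move=> SC SD SX s; have [n sn] := pcoef_supp s.
elim: n s sn => [|n IH] s sn.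
  rewrite (_ : s = pconst 0) //; apply: pcoef_ext => i; rewrite sn //.
  by rewrite pcoef_const; case: i.
have [t st] := polyext_decomp s; rewrite st; apply: (SD) => //; apply/SX/IH => i ni.
by rewrite -[LHS]add0r -[RHS](sn i.+1) // [in RHS]st pcoefD pcoefX pcoef_const.
Qed.

Lemma mulX_inj : injective (fun s : polyext => 'X *: s).
Proof.
move=> s t /= st; apply: pcoef_ext => i.
by have := congr1 (fun r => pcoef r i.+1) st; rewrite /= !pcoefX.
Qed.

(** The adjunction between extension and restriction of scalars: a map
    [M -> N] that is linear over [R] extends to [M[X]] by
    [sum_i m_i X^i |-> sum_i X^i f(m_i)]. *)
Lemma polyext_extend (N : lmodType {poly R}) (f : M -> N) :
  {morph f : x y / x + y} -> (forall a m, f (a *: m) = a%:P *: f m) ->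
  exists F : {linear polyext -> N}, forall m, F (pconst m) = f m.
Proof.
move=> fD fC; have f0 : f 0 = 0 by rewrite -(scale0r 0) fC scale0r.
pose g s i : N := 'X^i *: f (pcoef s i).
pose bd s := sval (cid (pcoef_supp s)).
have bdP s i : (bd s <= i)%N -> pcoef s i = 0.
  by rewrite /bd; case: cid => n /= h /h.
pose F s : N := \sum_(i < bd s) g s i.
have FE n s : (forall i, (n <= i)%N -> pcoef s i = 0) -> F s = \sum_(i < n) g s i.
  move=> sn; have g0 i : pcoef s i = 0 -> g s i = 0.
    by move=> si; rewrite /g si f0 scaler0.
  suff h m k : (forall i, (m <= i)%N -> pcoef s i = 0) -> (m <= k)%N ->
      \sum_(i < m) g s i = \sum_(i < k) g s i.
    rewrite /F (h _ (maxn (bd s) n) (bdP s)) ?leq_maxl //.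
    by rewrite (h n (maxn (bd s) n)) ?leq_maxr.
  move=> sm /subnKC <-; elim: (k - m)%N => [|j IH]; first by rewrite addn0.
  by rewrite addnS big_ord_recr /= -IH g0 ?addr0 // sm // leq_addr.
have FD : {morph F : s t / s + t}.
  move=> s t; pose n := maxn (bd s) (bd t).
  have sn i : (n <= i)%N -> pcoef s i = 0.
    by rewrite geq_max => /andP[/bdP].
  have tn i : (n <= i)%N -> pcoef t i = 0.
    by rewrite geq_max => /andP[_ /bdP].
  rewrite (FE n s) // (FE n t) // (FE n) => [|i ni]; last first.
    by rewrite pcoefD sn // tn // addr0.
  elim: (n) => [|k IH]; first by rewrite !big_ord0 addr0.
  rewrite !big_ord_recr /= IH addrACA; congr (_ + _).
  by rewrite /g pcoefD -scalerDr fD.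
have FC a s : F (a%:P *: s) = a%:P *: F s.
  rewrite (FE (bd s)) => [|i si]; last by rewrite pcoefC bdP // scaler0.
  rewrite (FE (bd s) s) //; last exact: bdP.
  elim: (bd s) => [|k IH]; first by rewrite !big_ord0 scaler0.
  rewrite !big_ord_recr /= IH scalerDr; congr (_ + _).
  by rewrite /g pcoefC scalerA mulrC -scalerA fC.
have FX s : F ('X *: s) = 'X *: F s.
  rewrite (FE (bd s).+1) => [|[|i] si]; last by rewrite pcoefX bdP.
    rewrite (FE (bd s) s) //; last exact: bdP.
    rewrite big_ord_recl {1}/g pcoefX f0 scaler0 add0r.
    elim: (bd s) => [|k IH]; first by rewrite !big_ord0 scaler0.
    rewrite !big_ord_recr /= IH scalerDr; congr (_ + _).
    by rewrite /g scalerA -exprS pcoefX.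
  by rewrite pcoefX.
exists (mk_linear (poly_linear FD FC FX)) => m.
rewrite mk_linearE (FE 1%N) => [|[|i] // _]; last by rewrite pcoef_const.
by rewrite big_ord1 /g expr0 scale1r pcoef_const.
Qed.

Lemma polyext_eq (N : lmodType {poly R}) (F G : {linear polyext -> N}) :
  (forall m, F (pconst m) = G (pconst m)) -> F =1 G.
Proof.
move=> FG; apply: polyext_ind => // [s t Fs Ft|s Fs]; first by rewrite !linearD Fs Ft.
by rewrite !linearZ Fs.
Qed.

(** A lifting problem for [M[X]] restricts to one for [M] over [R], and its
    solution extends back. *)
Lemma polyext_projective : projective M -> projective polyext.
Proof.
move=> pM N1 N2 p f sp.
have lf : linear (fun m => f (pconst m) : restrict_scalars N2).
  by move=> a u v; rewrite pconstD pconstC linearD linearZ.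
have [h hE] := pM _ _ (restrict_lin p) (mk_linear lf) sp.
have [H HE] : exists H : {linear polyext -> N1}, forall m, H (pconst m) = h m.
  apply: polyext_extend => [x y|a x]; first exact: (linearD h).
  by rewrite linearZ.
exists H; apply: (@polyext_eq N2 (lcomp p H) f) => m.
by rewrite linE HE; apply: hE.
Qed.

End Extension.

Lemma polyext_map (M N : lmodType R) (f : {linear M -> N}) :
  exists F : {linear polyext M -> polyext N},
    forall s i, pcoef (F s) i = f (pcoef s i).
Proof.
have [F FE] : exists F : {linear polyext M -> polyext N},
    forall m, F (pconst m) = pconst (f m).
  apply: polyext_extend => [x y|a x]; first by rewrite linearD pconstD.
  by rewrite linearZ pconstC.
exists F; apply: polyext_ind => [m i|s t Fs Ft i|s Fs i].
- by rewrite FE !pcoef_const; case: i => //=; rewrite linear0.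
- by rewrite linearD !pcoefD linearD Fs Ft.
- by rewrite linearZ !pcoefX; case: i => [|i]; rewrite ?linear0 ?Fs.
Qed.

Lemma polyext_map_const (M N : lmodType R) (f : {linear M -> N})
    (F : {linear polyext M -> polyext N}) :
  (forall s i, pcoef (F s) i = f (pcoef s i)) ->
  forall m, F (pconst m) = pconst (f m).
Proof.
move=> FE m; apply: pcoef_ext => -[|i]; rewrite FE !pcoef_const //.
exact: linear0.
Qed.

Lemma polyext_ses (A B C : lmodType R) (f : {linear A -> B})
    (g : {linear B -> C}) (F : {linear polyext A -> polyext B})
    (G : {linear polyext B -> polyext C}) :
  ses f g -> (forall s i, pcoef (F s) i = f (pcoef s i)) ->
  (forall s i, pcoef (G s) i = g (pcoef s i)) -> ses F G.
Proof.
move=> fg FE GE; have [fI ex sg] := fg; split.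
- move=> s t /(congr1 (@pcoef B)) st; apply: pcoef_ext => i; apply: fI.
  by rewrite -!FE st.
- move=> y; split=> [y0|[s <-]]; last first.
    by apply: pcoef_ext => i; rewrite GE FE (ses_comp0 _ fg) pcoef0.
  have h i : exists a, f a = pcoef y i by apply/ex; rewrite -GE y0 pcoef0.
  have [n yn] := pcoef_supp y.
  have [|s sE] := @polyext_build A (fun i => sval (cid (h i))) n.
    by move=> i /yn yi; apply: fI; case: cid => a /= ->; rewrite yi linear0.
  by exists s; apply: pcoef_ext => i; rewrite FE sE; case: cid.
- apply: polyext_ind => [c|s t [u <-] [v <-]|s [u <-]].
  + by have [b <-] := sg c; exists (pconst b); rewrite (polyext_map_const GE).
  + by exists (u + v); rewrite linearD.
  + by exists ('X *: u); rewrite linearZ.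
Qed.

(** [M[X] / X M[X]]. *)
Definition killX (M : lmodType R) : lmodType {poly R} := endo_module (zero_lin M M).

Lemma killXC (M : lmodType R) a (m : killX M) : a%:P *: m = a *: (m : M).
Proof. exact: endo_moduleC. Qed.

Lemma killXX (M : lmodType R) (m : killX M) : 'X *: m = 0.
Proof. exact: endo_moduleX. Qed.

Lemma killX_map (M N : lmodType R) (f : {linear M -> N}) :
  exists F : {linear killX M -> killX N}, forall x, F x = f x.
Proof.
have [fD fC fX] : [/\ {morph (f : killX M -> killX N) : x y / x + y},
    (forall a (x : killX M), (f (a%:P *: x) : killX N) = a%:P *: (f x : killX N)) &
    (forall x : killX M, (f ('X *: x) : killX N) = 'X *: (f x : killX N))].
  split; first by move=> x y; apply: (linearD f).
  - by move=> a x; rewrite !killXC; apply: (linear_scale f).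
  - by move=> x; rewrite !killXX; apply: (linear0 f).
by exists (mk_linear (poly_linear fD fC fX)).
Qed.

Lemma polyext_eval0 (P M : lmodType R) (g : {linear P -> M}) :
  exists e : {linear polyext P -> killX M}, forall s, e s = g (pcoef s 0).
Proof.
pose f s : killX M := g (pcoef s 0).
have fD : {morph f : x y / x + y}.
  by move=> x y; rewrite /f pcoefD; apply: (linearD g).
have fC a x : f (a%:P *: x) = a%:P *: f x.
  by rewrite /f pcoefC killXC; apply: (linear_scale g).
have fX x : f ('X *: x) = 'X *: f x.
  by rewrite /f pcoefX killXX; apply: (linear0 g).
by exists (mk_linear (poly_linear fD fC fX)).
Qed.

End PolynomialModules.

(** * Change of rings *)
Section Cone.
Variable S : comNzRingType.

(** Under the hypotheses [k |-> (F k, - c k)] is the kernel of the map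
    [(p, k) |-> c p + F k] from [P + K] onto [L], and the two maps found are the
    components of an extension of [U] along it. *)
Lemma ext1_zero_cone (K P L Q : lmodType S) (F : {linear K -> P})
    (l : {linear L -> P}) (c : S) :
  injective F -> injective l -> injective (fun p : P => c *: p) ->
  (forall k p, F k = c *: p -> exists k', k = c *: k') ->
  (forall s, (exists y, l y = s) <-> exists p k, s = c *: p + F k) ->
  ext1_zero L Q -> forall U : {linear K -> Q},
  exists (v : {linear P -> Q}) (w : {linear K -> Q}),
    forall k, v (F k) = U k + c *: w k.
Proof.
move=> FI lI cI Fc lim eL U.
pose a := pairing F (lcomp (opp_lin K) (scale_lin K c)).
have aE k : a k = (F k, - (c *: k)) by [].
have [b bE] : exists b : {linear (P <+> K) -> L},
    forall x, l (b x) = copair (scale_lin P c) F x.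
  by apply: lift_inj => // x; apply/lim; exists x.1, x.2.
have ab : ses a b.
  split.
  - by move=> k k'; rewrite !aE => -[/FI].
  - move=> [p k]; split=> [pk0|[k' <-]]; last first.
      by apply: lI; rewrite aE bE copairE /= linearN linearZ linear0 subrr.
    have := bE (p, k); rewrite pk0 linear0 linE /= => /esym /eqP.
    rewrite addrC addr_eq0 -scalerN => /eqP Fk; have [k' kE] := Fc _ _ Fk.
    exists (- k'); rewrite scalerN opprK -kE linearN; congr (_, _).
    apply: cI; rewrite /= scalerN -linearZ -kE Fk.
    by rewrite scalerN opprK.
  - move=> y; have [|p [k yE]] := (lim (l y)).1; first by exists y.
    by exists (p, k); apply: lI; rewrite bE yE.
have [W WE] := eL _ _ _ _ ab U.
exists (lcomp W (inl_lin P K)), (lcomp W (inr_lin P K)) => k.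
rewrite -WE aE !linE -linearZ -linearD; congr (W _).
by apply/pair_equal_spec; rewrite /= scaler0 addr0 addNr.
Qed.

End Cone.

Section ChangeOfRings.
Variable R : comNzRingType.
Implicit Types A B C K M N P Q : lmodType R.

(** [u : K -> Q] is recovered from [u[X]] by restricting to constants and taking
    constant coefficients, and so is an extension of it. *)
Lemma ext1_zero_polyext M Q :
  ext1_zero (polyext M) (polyext Q) -> ext1_zero M Q.
Proof.
move=> eM K B f g fg u.
have [F FE] := polyext_map f; have [G GE] := polyext_map g.
have [U UE] := polyext_map u.
have [W WE] := eM _ _ _ _ (polyext_ses fg FE GE) U.
have lv : linear (fun b => pcoef (W (pconst b)) 0).
  by move=> a x y; rewrite pconstD pconstC linearD linearZ pcoefD pcoefC.
exists (mk_linear lv) => k.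
rewrite mk_linearE -(polyext_map_const FE) WE (polyext_map_const UE).
exact: pcoef_const.
Qed.

(** [L] consists of the polynomials whose constant coefficient lies in [K].
    Taking the constant coefficient maps it onto [K], with kernel [X P[X]]. *)
Lemma killX_syzygy K P M (f : {linear K -> P}) (g : {linear P -> M})
    (L : lmodType {poly R}) (l : {linear L -> polyext P})
    (e : {linear polyext P -> killX M}) :
  ses f g -> ses l e -> (forall s, e s = g (pcoef s 0)) ->
  exists (u : {linear polyext P -> L}) (t : {linear L -> killX K}), ses u t.
Proof.
move=> fg le eE; have [fI ex sg] := fg; have [lI lex se] := le.
have [f0 f0E] := killX_map f.
have [ev evE] := polyext_eval0 (id_lin P).
have lker s : e s = 0 <-> exists k, f k = pcoef s 0 by rewrite eE; apply: ex.
have [u uE] : exists u : {linear polyext P -> L},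
    forall s, l (u s) = scale_lin (polyext P) 'X s.
  apply: lift_inj => // s; apply/lex/lker; exists 0.
  by rewrite /= pcoefX linear0.
have [t tE] : exists t : {linear L -> killX K},
    forall y, f0 (t y) = lcomp ev l y.
  apply: lift_inj => [x y|y]; first by rewrite !f0E => /fI.
  have /lker[k kE] : e (l y) = 0 by apply/lex; exists y.
  by exists k; rewrite f0E linE evE kE.
have tE' y : f (t y) = pcoef (l y) 0 by rewrite -f0E tE linE evE.
exists u, t; split.
- by move=> s s' /(congr1 l); rewrite !uE => /mulX_inj.
- move=> y; split=> [y0|[s <-]].
    have [s sE] := polyext_decomp (l y); exists s; apply: lI.
    rewrite uE [RHS]sE -tE' y0 [f 0]linear0 /=.
    rewrite (_ : pconst 0 = 0) ?add0r //; apply: pcoef_ext => i.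
    by rewrite pcoef_const; case: i.
  by apply: fI; rewrite tE' uE /= pcoefX [RHS]linear0.
- move=> k.
  have /lex[y yE] : e (pconst (f k)) = 0.
    by apply/lker; exists k; rewrite pcoef_const.
  by exists y; apply: fI; rewrite tE' yE pcoef_const.
Qed.

(** The dimension shift of Rees: by [Ext^1(L, Q[X]) = Ext^2(M, Q[X])], over
    [R[X]] with [X] killing [M], this is [Ext^1(M, Q)] over [R]. Explicitly,
    [L = X P[X] + K[X]], so [ext1_zero_cone] gives [v] on [P[X]] with
    [v k = u k + X w k] for [k] in [K[X]]; the constant coefficient of [v]
    extends [u]. *)
Lemma ext1_zero_killX_syzygy K P M Q (f : {linear K -> P})
    (g : {linear P -> M}) (L : lmodType {poly R}) (l : {linear L -> polyext P})
    (e : {linear polyext P -> killX M}) :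
  ses f g -> projective P -> ses l e -> (forall s, e s = g (pcoef s 0)) ->
  ext1_zero L (polyext Q) -> ext1_zero M Q.
Proof.
move=> fg pP le eE eL; apply: (ext1_zero_presentation fg) => // u.
have [fI ex sg] := fg; have [lI lex se] := le.
have [F FE] := polyext_map f; have [U UE] := polyext_map u.
have FI : injective F.
  by have [G GE] := polyext_map g; have [] := polyext_ses fg FE GE.
have FX k p : F k = 'X *: p -> exists k', k = 'X *: k'.
  move=> Fk; have k0 : pcoef k 0 = 0.
    by apply: fI; rewrite -FE Fk pcoefX linear0.
  have [k' kE] := polyext_decomp k; exists k'.
  rewrite [LHS]kE k0 -[RHS]add0r; congr (_ + _); apply: pcoef_ext => i.
  by rewrite pcoef_const; case: i.
have lim s : (exists y, l y = s) <-> exists p k, s = 'X *: p + F k.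
  rewrite -(lex s) eE; split=> [/ex[k kE]|[p [k ->]]].
    have [p sE] := polyext_decomp s; exists p, (pconst k).
    by rewrite (polyext_map_const FE) kE addrC.
  by rewrite pcoefD pcoefX FE add0r (ses_comp0 _ fg).
have [v [w vw]] := ext1_zero_cone FI lI (@mulX_inj _ P) FX lim eL U.
have lv : linear (fun p => pcoef (v (pconst p)) 0).
  by move=> a x y; rewrite pconstD pconstC linearD linearZ pcoefD pcoefC.
exists (mk_linear lv) => k.
rewrite mk_linearE -(polyext_map_const FE) vw pcoefD pcoefX addr0.
by rewrite (polyext_map_const UE) pcoef_const.
Qed.

(** Syzygies of [M] extend to syzygies of [M[X]], which reduces the claim to
    [d = 0]. There [M] has a presentation by Gorenstein projective modules and
    [Ext^1(M, Q) = 0] for [Q] projective, by [ext1_zero_polyext]. Finiteness of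
    the dimension over [R] starts the induction. *)
Lemma gpd_le_polyext (N d : nat) M :
  gpd_le N M -> gpd_le d (polyext M) -> gpd_le d M.
Proof.
elim: N d M => [|N IH] d M; first by move=> gM _; apply: gp_gpd_le.
move=> [K [P [f [g [fg pP gK]]]]] gMX.
have [F FE] := polyext_map f; have [G GE] := polyext_map g.
have gKX := gpd_le_syzygy (polyext_ses fg FE GE) (polyext_projective pP) gMX.
have {}gK := IH _ _ gK gKX.
case: d gMX gKX gK => [|d] gMX gKX gK; last by exists K, P, f, g.
apply: gp_cokernel fg gK (gp_projective pP) _ => Q pQ.
have [_ [_ [_ [_ [_ _ _ eMX]]]]] := gp_left_sequence gMX.
exact: ext1_zero_polyext (eMX _ (polyext_projective pQ)).
Qed.

(** Killing [X] raises the dimension by one. In the inductive step,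
    [killX_syzygy] presents [K], with [X] acting by zero, as the quotient of the
    syzygy [L] of [M] by a projective module, so [K] satisfies the same bound as
    [L] when this bound is positive. *)
Lemma gpd_le_killX (d : nat) M :
  gpd_le d.+1 M -> gpd_le d.+1 (killX M) -> gpd_le d M.
Proof.
elim: d M => [|d IH] M [K [P [f [g [fg pP gK]]]]] gM0.
all: have [e eE] := polyext_eval0 g; have se : surj e.
1,3: by move=> m; have [_ _ sg] := fg; have [p <-] := sg m;
        exists (pconst p); rewrite eE pcoef_const.
all: have [L [l le]] := kernel_exists se.
all: have gL := gpd_le_syzygy le (polyext_projective pP) gM0.
  apply: (gp_cokernel fg gK (gp_projective pP)) => Q pQ.
  have [_ [_ [_ [_ [_ _ _ eL]]]]] := gp_left_sequence gL.
  apply: (ext1_zero_killX_syzygy fg pP le eE).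
  exact: eL _ (polyext_projective pQ).
exists K, P, f, g; split=> //; apply: IH => //.
have [u [t ut]] := killX_syzygy fg le eE.
apply: gpd_le_cokernel ut _ gL.
exact: gp_gpd_le (gp_projective (polyext_projective pP)).
Qed.

End ChangeOfRings.

(** * Finite presentations *)
Section FinitePresentation.
Variable R : comNzRingType.
Implicit Types A B C F K M N P Q : lmodType R.

Fixpoint npres (n : nat) M : Prop :=
  if n is m.+1 then
    exists K F (f : {linear K -> F}) (g : {linear F -> M}),
      [/\ ses f g, fg_free F & npres m K]
  else exists F (g : {linear F -> M}), fg_free F /\ surj g.

Lemma n_presented_npres n M : n_presented n M -> npres n M.
Proof.
elim: n M => [|n IH] M [F [d [e [ff se ex exi]]]].
  by exists (F 0%N), e; split=> //; apply: ff.
have [K [k ke]] := kernel_exists se; have [kI kE _] := ke.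
have ex0 := ex isT.
have [t tE] : exists t : {linear F 1%N -> K}, forall x, k (t x) = d 0%N x.
  by apply: lift_inj => // x; apply/kE/ex0; exists x.
exists K, (F 0%N), k, e; split=> //; first exact: ff.
apply: IH; exists (fun i => F i.+1), (fun i => d i.+1), t; split.
- by move=> i ni; apply: ff.
- move=> y; have /ex0[x xE] : e (k y) = 0 by apply/kE; exists y.
  by exists x; apply: kI; rewrite tE.
- move=> n0 y; rewrite -(exi 0%N) // -tE.
  by split=> [->|]; rewrite ?linear0 // -[X in _ = X](linear0 k) => /kI.
- by move=> i ni; apply: exi.
Qed.

Lemma npres_n_presented n M : npres n M -> n_presented n M.
Proof.
elim: n M => [|n IH] M /=.
  move=> [F [g [fF sg]]].
  exists (fun=> F), (fun=> zero_lin F F), g; split=> //.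
move=> [K [F [f [g [fg fF /IH[G [d [e [ff se ex exi]]]]]]]]].
have [fI fE sg] := fg.
exists (cons_mod F G), (cons_chain (lcomp f e) d), g; split=> //.
- by case=> [|i] //= ni; apply: ff.
- move=> _ y; split=> [/fE[x <-]|[x <-]]; last exact: (ses_comp0 _ fg).
  by have [z <-] := se x; exists z.
- case=> [|i] ni /=; last exact: exi.
  have ex0 := ex ni; move=> y; split=> [|/ex0 y0]; last by rewrite linE y0 linear0.
  by rewrite linE -[X in _ = X](linear0 f) => /fI/ex0.
Qed.

Lemma rowv_projective k : projective 'rV[R]_k.
Proof.
move=> M N p f sp.
pose m j := sval (cid (sp (f (delta_mx 0 j)))).
have mE j : p (m j) = f (delta_mx 0 j) by rewrite /m; case: cid.
have hl : linear (fun v : 'rV[R]_k => \sum_(j < k) v 0 j *: m j).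
  move=> a u v; rewrite scaler_sumr -big_split; apply: eq_bigr => j _.
  by rewrite !mxE scalerDl scalerA.
exists (mk_linear hl) => v; rewrite mk_linearE [in RHS](row_sum_delta v).
rewrite !linear_sum; apply: eq_bigr => j _.
by rewrite !linearZ mE.
Qed.

Lemma fg_free_projective F : fg_free F -> projective F.
Proof.
move=> [k [b [b' bK b'K]]].
have lb : linear b'.
  by move=> a u v; apply: (can_inj bK); rewrite linearP !b'K.
apply: (@projective_retract _ _ _ (mk_linear lb) b b'K).
exact: rowv_projective.
Qed.

Lemma inj_surj_bij A B (f : {linear A -> B}) :
  injective f -> surj f -> bijective f.
Proof.
move=> fI sf; pose g y := sval (cid (sf y)).
have fK y : f (g y) = y by rewrite /g; case: cid.
by exists g => // x; apply: fI; rewrite fK.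
Qed.

Lemma fg_free_iso A B (f : {linear A -> B}) :
  injective f -> surj f -> fg_free A -> fg_free B.
Proof.
move=> fI sf [k [b bb]]; exists k, (lcomp f b).
exact: bij_comp (inj_surj_bij fI sf) bb.
Qed.

Lemma fg_free_rowv k : fg_free 'rV[R]_k.
Proof. by exists k, (id_lin _); exists id. Qed.

Lemma fg_free_sum A B : fg_free A -> fg_free B -> fg_free (A <+> B).
Proof.
move=> [k [a [a' aK a'K]]] [m [b [b' bK b'K]]].
exists (k + m)%N.
have lf : linear (fun v : 'rV[R]_(k + m) => (a (lsubmx v), b (rsubmx v))).
  by move=> c u v; apply/pair_equal_spec; rewrite /= !linearP.
exists (mk_linear lf); exists (fun x => row_mx (a' x.1) (b' x.2)).
  by move=> v; rewrite /= aK bK hsubmxK.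
by move=> [x y]; rewrite /= row_mxKl row_mxKr a'K b'K.
Qed.

Lemma npres_fg_free n F : fg_free F -> npres n F.
Proof.
elim: n F => [|n IH] F fF /=.
  by exists F, (id_lin F); split=> // x; exists x.
exists 'rV[R]_0, F, (zero_lin _ _), (id_lin F); split=> //.
  exact/ses_0id/rV0_eq0.
exact/IH/fg_free_rowv.
Qed.

(** A common form for the two cases of [npres], so that they can be treated
    together. *)
Lemma npres_cover n M : npres n M ->
  exists K F (f : {linear K -> F}) (g : {linear F -> M}),
    [/\ ses f g, fg_free F & if n is m.+1 then npres m K else True].
Proof.
case: n => // -[F [g [fF /kernel_exists[K [f fg]]]]].
by exists K, F, f, g.
Qed.

Lemma npres_extension n A B C (f : {linear A -> B}) (g : {linear B -> C}) :
  ses f g -> npres n A -> npres n C -> npres n B.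
Proof.
elim: n A B C f g => [|n IH] A B C f g fg.
all: move=> /npres_cover[A' [FA [a1 [a0 [aS fA nA]]]]].
all: move=> /npres_cover[C' [FC [c1 [c0 [cS fC nC]]]]].
all: have [B' [b1 [b0 [s [t [bS stS]]]]]] :=
  horseshoe fg aS cS (fg_free_projective fC).
  by exists (FA <+> FC), b0; split; [apply: fg_free_sum | case: bS].
exists B', (FA <+> FC), b1, b0; split=> //; first exact: fg_free_sum.
exact: IH stS nA nC.
Qed.

End FinitePresentation.

Section FinitePresentationPoly.
Variable R : comNzRingType.
Implicit Types A B C F K M N P Q : lmodType R.

(** A row of polynomials is a polynomial with rows as coefficients. *)
Lemma polyext_rowv k : exists g : {linear 'rV[{poly R}]_k -> polyext 'rV[R]_k},
  injective g /\ surj g.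
Proof.
have bd (v : 'rV[{poly R}]_k) i : (\max_(j < k) size (v 0%R j) <= i)%N ->
    (\row_j (v 0 j)`_i : 'rV[R]_k) = 0.
  move=> le; apply/rowP => j; rewrite !mxE nth_default //.
  by apply: leq_trans le; apply: (leq_bigmax j).
pose g v := sval (cid (polyext_build (bd v))).
have gE v i : pcoef (g v) i = \row_j (v 0 j)`_i by rewrite /g; case: cid.
have gD : {morph g : u v / u + v}.
  move=> u v; apply: pcoef_ext => i; rewrite pcoefD !gE.
  by apply/rowP => j; rewrite !mxE coefD.
have gC a v : g (a%:P *: v) = a%:P *: g v.
  apply: pcoef_ext => i; rewrite pcoefC !gE; apply/rowP => j.
  by rewrite !mxE coefCM.
have gX v : g ('X *: v) = 'X *: g v.
  apply: pcoef_ext => i; rewrite pcoefX gE; case: i => [|i]; last rewrite gE.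
    by apply/rowP => j; rewrite !mxE coefXM.
  by apply/rowP => j; rewrite !mxE coefXM.
exists (mk_linear (poly_linear gD gC gX)); split.
  move=> u v uv; apply/rowP => j; apply/polyP => i.
  have := congr1 (fun s => pcoef s i) uv; rewrite !mk_linearE !gE.
  by move/rowP/(_ j); rewrite !mxE.
move=> s; have [n sn] := pcoef_supp s.
exists (\row_j \poly_(i < n) pcoef s i 0 j); apply: pcoef_ext => i.
rewrite mk_linearE gE; apply/rowP => j; rewrite !mxE coef_poly.
by case: ltnP => // /sn ->; rewrite mxE.
Qed.

Lemma fg_free_polyext F : fg_free F -> fg_free (polyext F).
Proof.
move=> [k [b [b' bK b'K]]].
have [g [gI sg]] := polyext_rowv k; have [B BE] := polyext_map b.
apply: (@fg_free_iso _ _ _ (lcomp B g)) (fg_free_rowv _ k).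
- move=> x y /= BxBy; apply: gI; apply: pcoef_ext => i; apply: (can_inj bK).
  by rewrite -!BE; congr pcoef.
- have bS : ses b (zero_lin F 'rV[R]_0).
    split; first exact: can_inj bK.
      by move=> y; split=> // _; exists (b' y).
    by move=> y; exists 0; rewrite [RHS]rV0_eq0.
  have [Z ZE] := polyext_map (zero_lin F 'rV[R]_0).
  have [_ ex _] := polyext_ses bS BE ZE.
  move=> y; have /ex[x <-] : Z y = 0 by apply: pcoef_ext => i; rewrite ZE.
  by have [v <-] := sg x; exists v.
Qed.

Lemma npres_polyext n M : npres n M -> npres n (polyext M).
Proof.
elim: n M => [|n IH] M.
all: move=> /npres_cover[K [F [f [g [fg fF nK]]]]].
all: have [f' f'E] := polyext_map f; have [g' g'E] := polyext_map g.
all: have fg' := polyext_ses fg f'E g'E; have fF' := fg_free_polyext fF.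
  by exists (polyext F), g'; split=> //; case: fg'.
by exists (polyext K), (polyext F), f', g'; split=> //; apply: IH.
Qed.

(** By [killX_syzygy], the syzygy over [R[X]] is an extension of the syzygy over
    [R], on which [X] acts by zero, by a finitely generated free module. *)
Lemma npres_killX n M : npres n M -> npres n (killX M).
Proof.
elim: n M => [|n IH] M.
all: move=> /npres_cover[K [F [f [g [fg fF nK]]]]].
all: have [e eE] := polyext_eval0 g; have se : surj e.
1,3: by move=> m; have [_ _ sg] := fg; have [p <-] := sg m;
        exists (pconst p); rewrite eE pcoef_const.
all: have fF' := fg_free_polyext fF.
  by exists (polyext F), e.
have [L [l le]] := kernel_exists se.
exists L, (polyext F), l, e; split=> //.
have [u [t ut]] := killX_syzygy fg le eE.
exact: npres_extension ut (npres_fg_free n fF') (IH _ nK).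
Qed.

Lemma n_presented_polyext n M : n_presented n M -> n_presented n (polyext M).
Proof. by move=> /n_presented_npres/npres_polyext/npres_n_presented. Qed.

Lemma n_presented_killX n M : n_presented n M -> n_presented n (killX M).
Proof. by move=> /n_presented_npres/npres_killX/npres_n_presented. Qed.

End FinitePresentationPoly.

(** * Transfer between a ring and its polynomial ring *)
Section Main.
Variable R : comNzRingType.

Lemma G_ring_descent n d : enat_finite (Ggldim R) ->
  G_ring {poly R} n d -> G_ring R n d.
Proof.
move=> fin GRX M nM; apply/Gpd_leP.
have [k le_k] : exists k, enat_le (Ggldim R) k.
  by case: (Ggldim R) fin => [k|] // _; exists k => /=.
have [N _ gN] := (enat_inf_leP _ _).1 le_k.
apply: (@gpd_le_polyext _ N); first exact/Gpd_leP/gN.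
exact/Gpd_leP/GRX/n_presented_polyext.
Qed.

Lemma G_ring_drop n d : G_ring R n d.+1 -> G_ring {poly R} n d.+1 ->
  G_ring R n d.
Proof.
move=> GR GRX M nM; apply/Gpd_leP/gpd_le_killX; first exact/Gpd_leP/GR.
exact/Gpd_leP/GRX/n_presented_killX.
Qed.

End Main.

Theorem theorem2p6 (R : comNzRingType) (n d : nat) :
  (enat_finite (Ggldim R) -> G_ring {poly R} n d -> G_ring R n d) /\
  ((1 <= d)%N ->
     G_ring R n d -> ~ G_ring R n (d - 1)%N -> ~ G_ring {poly R} n d) /\
  ((1 <= d)%N ->
     enat_finite (Ggldim R) -> G_ring {poly R} n d -> G_ring R n (d - 1)%N).
Proof.
split; first exact: G_ring_descent.
split; case: d => // d _; rewrite subn1 /=.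
  by move=> GR nGR GRX; apply: nGR (G_ring_drop GR GRX).
by move=> fin GRX; apply: G_ring_drop (G_ring_descent fin GRX) GRX.
Qed.
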